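(* Let $F$ be a field and let $V$ be a four-dimensional vector space over $F$. There is a one-one correspondence between the Clifford parallelisms of $\mathbb{P}(V)$ and those planes of $\mathbb{P}(V\wedge V)$ that are external to the Klein quadric $\mathcal{Q}$, namely: the assignment $C\mapsto{\parallel_C}$ is a bijection from the set of all planes $C$ of $\mathbb{P}(V\wedge V)$ that have no point in common with $\mathcal{Q}$ onto the set of all Clifford parallelisms of $\mathbb{P}(V)$.
   Context: Fields are commutative and of arbitrary characteristic. For a vector space $U$ over $F$, $\mathbb{P}(U)$ is the projective space of all subspaces of $U$; points, lines, planes are the subspaces of vector dimension $1,2,3$. The Plücker embedding $\gamma$ maps a line $M$ of $\mathbb{P}(V)$ to the point $M^\gamma=F(u\wedge v)$ of $\mathbb{P}(V\wedge V)$, where $u,v$ is any basis of $M$; the Klein quadric $\mathcal{Q}$ is the image of $\gamma$. A parallelism of $\mathbb{P}(V)$ is an equivalence relation on the set of lines such that each point is incident with precisely one line from each equivalence class. For a plane $C$ of $\mathbb{P}(V\wedge V)$ having no point in common with $\mathcal{Q}$, lines $M,N$ satisfy $M\parallel_C N$ if $C+M^\gamma=C+N^\gamma$. Conditions on an $F$-algebra $H$ (with $F$ identified with $F\cdot 1_H$): (A) $H$ is a quaternion skew field with centre $F$ (so $[H:F]=4$); (B) $H$ is an extension field of $F$ with $[H:F]=4$ and $h^2\in F$ for all $h\in H$. For such $H$, lines $M,N$ of $\mathbb{P}(H)$ are left parallel if $cM=N$ for some $c\in H\setminus\{0\}$, and right parallel if $Mc=N$ for some $c\in H\setminus\{0\}$;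 these two parallelisms are the canonical Clifford parallelisms of $\mathbb{P}(H)$. A parallelism $\parallel$ of $\mathbb{P}(V)$ is Clifford if the $F$-vector space $V$ can be made into an $F$-algebra $H:=V$ satisfying (A) or (B) such that $\parallel$ coincides with one of the canonical Clifford parallelisms of $\mathbb{P}(H)$. *)

(* Defs.v *)
From HB Require Import structures.
From mathcomp Require Import all_boot all_algebra.
From mathcomp Require Import classical_sets functions.
From Corelib Require Import RelationClasses.

Set Implicit Arguments.
Unset Strict Implicit.
Unset Printing Implicit Defensive.

Import GRing.Theory.
Local Open Scope ring_scope.

Section ExteriorSquare.
Variables (F : fieldType) (V : vectType F).

Definition bilinear_map (U : lmodType F) (b : V -> V -> U) : Prop :=
  (forall x, linear (b x)) /\ (forall y, linear (b^~ y)).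

Definition alternating_map (U : lmodType F) (b : V -> V -> U) : Prop :=
  bilinear_map b /\ forall x, b x x = 0.

(* [V /\ V] is given by its universal property: any two pairs [(W, w)] with
   this property are isomorphic by a unique linear map compatible with the
   products. Lemma [exterior_square_exists] below provides such a pair. *)
Definition is_exterior_square (W : vectType F) (w : V -> V -> W) : Prop :=
  alternating_map w /\
  forall (U : lmodType F) (b : V -> V -> U), alternating_map b ->
    exists f : {linear W -> U}, (forall x y, f (w x y) = b x y) /\
      forall g : {linear W -> U}, (forall x y, g (w x y) = b x y) -> g =1 f.

End ExteriorSquare.

Section Geometry.
Variables (F : fieldType) (V : vectType F).

Definition point : Type := {X : {vspace V} | \dim X == 1%N}.
Definition line : Type := {M : {vspace V} | \dim M == 2%N}.

Definition is_plane (C : {vspace V}) : Prop := \dim C = 3%N.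

Definition is_parallelism (P : line -> line -> Prop) : Prop :=
  Equivalence P /\
  forall (X : point) (L : line),
    exists! M : line, P L M /\ (val X <= val M)%VS.

End Geometry.

Section Klein.
Variables (F : fieldType) (V W : vectType F) (w : V -> V -> W).

(* For an alternating [w], [vbasis M] may be replaced by any basis of [M]:
   see [plucker_basis]. *)
Definition plucker (M : line V) : {vspace W} :=
  <[w (vbasis (val M))`_0 (vbasis (val M))`_1]>%VS.

Definition klein_quadric : set {vspace W} := range plucker.

Definition external_plane (C : {vspace W}) : Prop :=
  is_plane C /\
  forall X : point W, (val X <= C)%VS -> ~ klein_quadric (val X).

Definition par_plane (C : {vspace W}) (M N : line V) : Prop :=
  (C + plucker M)%VS = (C + plucker N)%VS.

End Klein.

(* Associative unital algebra structures on the vector space [V] itself; the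
   library's algebra structures would need a fresh carrier for each product. *)
Record algebra_on (F : fieldType) (V : vectType F) := AlgebraOn {
  amul : V -> V -> V;
  aone : V;
  amul_bilinear : bilinear_map amul;
  amulA : associative amul;
  amul1l : left_id aone amul;
  amul1r : right_id aone amul
}.

Section Clifford.
Variables (F : fieldType) (V : vectType F) (H : algebra_on V).

Local Notation "x ** y" := (amul H x y) (at level 40, left associativity).
Local Notation "1H" := (aone H).

Definition is_skew_field : Prop :=
  1H <> 0 /\ forall x, x <> 0 -> exists y, x ** y = 1H /\ y ** x = 1H.

(* [<[1H]>] is the copy [F . 1] of [F] in [H]. *)
Definition has_centre_F : Prop :=
  forall z, (forall x, z ** x = x ** z) <-> z \in <[1H]>%VS.

(* A quaternion skew field is a skew field of dimension 4 over its centre. *)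
Definition is_quaternion_skew_field : Prop :=
  [/\ is_skew_field, has_centre_F & \dim {:V} = 4%N].

Definition is_square_central_quartic_field : Prop :=
  [/\ is_skew_field, commutative (amul H), \dim {:V} = 4%N
    & forall h, h ** h \in <[1H]>%VS].

Definition left_parallel (M N : line V) : Prop :=
  exists c : V, c <> 0 /\ (linfun (amul H c) @: val M)%VS = val N.

Definition right_parallel (M N : line V) : Prop :=
  exists c : V, c <> 0 /\ (linfun ((amul H)^~ c) @: val M)%VS = val N.

End Clifford.

Definition is_clifford (F : fieldType) (V : vectType F)
    (P : line V -> line V -> Prop) : Prop :=
  is_parallelism P /\
  exists H : algebra_on V,
    (is_quaternion_skew_field H \/ is_square_central_quartic_field H) /\
    ((forall M N, P M N <-> left_parallel H M N) \/
     (forall M N, P M N <-> right_parallel H M N)).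

Section BilinearTheory.
Variables (F : fieldType) (V : vectType F) (U : lmodType F) (b : V -> V -> U).

Lemma bilinear_map_suml (bB : bilinear_map b) I (r : seq I) a (g : I -> V) y :
  b (\sum_(i <- r) a i *: g i) y = \sum_(i <- r) a i *: b (g i) y.
Proof.
pose f : {linear V -> U} := HB.pack (b^~ y) (GRing.isLinear.Build _ _ _ _ _ (bB.2 y)).
rewrite -[LHS]/(f _) linear_sum; apply: eq_bigr => i _.
by rewrite linearZ.
Qed.

Lemma bilinear_map_sumr (bB : bilinear_map b) I (r : seq I) a (g : I -> V) x :
  b x (\sum_(i <- r) a i *: g i) = \sum_(i <- r) a i *: b x (g i).
Proof.
pose f : {linear V -> U} := HB.pack (b x) (GRing.isLinear.Build _ _ _ _ _ (bB.1 x)).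
rewrite -[LHS]/(f _) linear_sum; apply: eq_bigr => i _.
by rewrite linearZ.
Qed.

Lemma alternating_mapC (bA : alternating_map b) x y : b x y = - b y x.
Proof.
have [bB b0] := bA; have := b0 (x + y).
have Dl u v z : b (u + v) z = b u z + b v z.
  by have := bB.2 z 1 u v; rewrite !scale1r.
have Dr u v z : b z (u + v) = b z u + b z v.
  by have := bB.1 z 1 u v; rewrite !scale1r.
by rewrite Dl !Dr !b0 add0r addr0 => /eqP; rewrite addr_eq0 => /eqP.
Qed.

End BilinearTheory.

Lemma alternating_map_span2 (F : fieldType) (V W : vectType F) (w : V -> V -> W)
    (u v x y : V) :
  alternating_map w -> x \in <<[:: u; v]>>%VS -> y \in <<[:: u; v]>>%VS ->
  w x y \in <[w u v]>%VS.
Proof.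
move=> wA /(coord_span (X := [tuple u; v])) -> /(coord_span (X := [tuple u; v])) ->.
rewrite bilinear_map_suml; last exact: wA.1.
rewrite big_ord_recl big_ord1 !bilinear_map_sumr; try exact: wA.1.
rewrite !big_ord_recl !big_ord0 /= !wA.2 (alternating_mapC wA v u).
by rewrite !(scaler0, add0r, addr0) memvD ?memvZ ?rpredN ?memv_line.
Qed.

Lemma plucker_basis (F : fieldType) (V W : vectType F) (w : V -> V -> W)
    (M : line V) (u v : V) :
  alternating_map w -> basis_of (val M) [:: u; v] -> plucker w M = <[w u v]>%VS.
Proof.
move=> wA /andP[/eqP sM _]; rewrite /plucker.
have szM : size (vbasis (val M)) = 2 by rewrite size_tuple; apply/eqP/(valP M).
have := span_basis (vbasisP (val M)).
case: (tval (vbasis (val M))) szM => [|x [|y []]] //= _ sxy.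
have sE : <<[:: x; y]>>%VS = <<[:: u; v]>>%VS by rewrite sM.
apply: subv_anti; rewrite -!memvE; apply/andP; split.
  by apply: alternating_map_span2; rewrite // -sE memv_span ?inE ?eqxx ?orbT.
by apply: alternating_map_span2; rewrite // sE memv_span ?inE ?eqxx ?orbT.
Qed.

Lemma exterior_square_exists (F : fieldType) (V : vectType F) :
  exists (W : vectType F) (w : V -> V -> W), is_exterior_square w.
Proof.
pose n := \dim {:V}; pose e := vbasis {:V}.
pose I : finType := {p : 'I_n * 'I_n | (p.1 < p.2)%N}.
pose c i x := coord e i x.
pose w (x y : V) : {ffun I -> F^o} :=
  [ffun p => c (val p).1 x * c (val p).2 y - c (val p).2 x * c (val p).1 y].
have eE x : x = \sum_(i < n) c i x *: e`_i by apply: coord_basis (vbasisP _) (memvf x).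
have cP i a x y : c i (a *: x + y) = a * c i x + c i y by rewrite /c linearP.
have wA : alternating_map w.
  split; last by move=> x; apply/ffunP=> p; rewrite !ffunE mulrC subrr.
  split=> x a y z; apply/ffunP=> p; rewrite !ffunE !cP.
    rewrite [RHS]/(a * _ + _) mulrBr !mulrDr !(mulrCA _ a).
    by rewrite opprD addrACA.
  rewrite [RHS]/(a * _ + _) mulrBr !mulrDl -!mulrA.
  by rewrite opprD addrACA.
have ce i (j : 'I_n) : c i e`_j = (i == j)%:R.
  by rewrite /c coord_free ?(basis_free (vbasisP _)) // eq_sym.
have wE (x : {ffun I -> F^o}) : x = \sum_(p : I) x p *: w e`_(val p).1 e`_(val p).2.
  apply/ffunP=> q; rewrite sum_ffunE (bigD1 q) //= big1 ?addr0.
    case: q => -[i j] /= ij; rewrite !ffunE /= !ce !eqxx.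
    have /negbTE-> : j != i by rewrite neq_ltn ij orbT.
    by rewrite mul0r subr0 mulr1 /GRing.scale /= mulr1.
  move=> p pq; rewrite !ffunE !ce.
  case: p q pq => -[i j] /= ij [[k l] /= kl]; rewrite -val_eqE /= xpair_eqE => pq.
  have -> : (k == i)%:R * (l == j)%:R = 0 :> F.
    by rewrite -natrM mulnb eq_sym [l == j]eq_sym (negbTE pq).
  have -> : (l == i)%:R * (k == j)%:R = 0 :> F.
    rewrite -natrM mulnb; case: eqP => // li; case: eqP => // kj.
    by move: ij kl; rewrite -li -kj => /ltn_trans/[apply]; rewrite ltnn.
  by rewrite subr0 scaler0.
exists {ffun I -> F^o}, w; split=> // U b bA.
pose f0 (x : {ffun I -> F^o}) := \sum_(p : I) (x p : F) *: b e`_(val p).1 e`_(val p).2.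
have f0L : linear f0.
  move=> a x y; rewrite /f0 scaler_sumr -big_split; apply: eq_bigr => p _.
  by rewrite !ffunE scalerDl scalerA.
pose f : {linear {ffun I -> F^o} -> U} :=
  HB.pack f0 (GRing.isLinear.Build _ _ _ _ _ f0L).
exists f; split=> [x y|g gw x]; last first.
  rewrite {1}(wE x) linear_sum /= /f0; apply: eq_bigr => p _.
  by rewrite linearZ gw.
rewrite /= /f0 [in RHS](eE x) (bilinear_map_suml bA.1).
under [RHS]eq_bigr => i _ do rewrite [in b _ y](eE y) (bilinear_map_sumr bA.1) scaler_sumr.
rewrite pair_big /=.
pose G (p : 'I_n * 'I_n) := c p.1 x *: (c p.2 y *: b e`_p.1 e`_p.2).
rewrite -/(\sum_p G p) (bigID (fun p : 'I_n * 'I_n => p.1 < p.2)%N) /=.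
pose sw (p : 'I_n * 'I_n) := (p.2, p.1).
have swK : involutive sw by case.
have -> : \sum_(p : 'I_n * 'I_n | ~~ (p.1 < p.2)%N) G p = \sum_(p : 'I_n * 'I_n | (p.1 < p.2)%N) G (sw p).
  rewrite (bigID (fun p : 'I_n * 'I_n => p.1 == p.2)) /= big1 ?add0r.
    rewrite (reindex_inj (inv_inj swK)); apply: eq_bigl => -[i j] /=.
    by rewrite -leqNgt ltn_neqAle eq_sym andbC.
  by move=> [i j] /= /andP[_ /eqP->]; rewrite /G /= bA.2 !scaler0.
rewrite -big_split /= [RHS](reindex_omap (val : I -> _) insub); last first.
  by move=> p pP; rewrite insubT.
apply: eq_big => [p|p _]; first by rewrite (valP p) valK eqxx.
rewrite ffunE /G /= (alternating_mapC bA e`_(val p).2) !scalerN scalerBl !scalerA.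
by rewrite mulrC.
Qed.

(* Main.v *)
Require Import Defs.
From mathcomp Require Import all_boot all_algebra.
From mathcomp Require Import classical_sets functions.
From HB Require Import structures.
From mathcomp Require Import boolp ring.

(** A line of P(V) is turned into a direction, a point of a projective plane,
by an alternating map b : V -> V -> Q whose values span a space K of dimension
3 and which vanishes only on dependent pairs: the line through u and v gets the
direction <[b u v]>. Call such a b a direction map. For x <> 0 the map b x has
kernel <[x]>, so it is onto K by counting dimensions; hence each point lies on
exactly one line of each direction, and having the same direction is a
parallelism ([same_direction_parallelism]).

External planes and direction maps are the same thing. If C is external to the
Klein quadric, then W is the direct sum of C and of the space w e V of all
w e x, for any e <> 0, since w e V has dimension 3, \dim W = 6, and every
nonzero w e x spans a point of the quadric. Composing w with the projection
onto w e V along C gives a direction map whose parallelism is that of C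
([external_projection]); conversely the kernel of the linear map W -> Q
induced by a direction map is an external plane ([direction_map_external]).

Injectivity. For all external planes the direction maps just described take the
values b e x = w e x. Two direction maps b, b' into the same K with the same
parallelism and with b e = b' e have b' u v proportional to b u v, because
b u v is some b e x. For e, u, v independent, comparing the factors for the
pairs (u, v), (u, e) and (u, v + e) shows that they are all 1
([direction_rigid]), so b = b' and the two projections of W coincide.

From algebras to planes. If H is an algebra of type (A) or (B), there is a
linear map s with s x * x a scalar for all x and s x <> 0 for x <> 0: the
quaternion conjugation in case (A), the identity in case (B). Then s u * v
modulo the scalars is a direction map; it is u^-1 v up to a scalar, so it takes
proportional values at (u, v) and (c u, c v), and lines have the same direction
exactly when they are left parallel ([conjugation_direction_map]). Right
parallels are left parallels of the opposite algebra.

From planes to algebras. Coordinates on K turn b into three alternating forms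
w0, w1, w2 all of whose nonzero combinations are nondegenerate. Write
w1 x y = w0 (S x) y and w2 x y = w0 (T x) y. Since w0 (S x) x = 0, the operator
S is self-adjoint and satisfies a quadratic equation, and so do T and S + T
([net_quadratic]). Hence 1, S, T, S T span an algebra of operators. It is a
division algebra, because the nonzero elements of the span of 1, S, T are
invertible, and evaluation at a vector e identifies it with V
([net_algebra]), its elements acting as right multiplications. Either S and T
do not commute and the centre is the field of scalars, or they commute,
the characteristic is 2 and all squares are scalars
([net_algebra_clifford]). The values of w0, w1, w2 at (u, u h) are a common
factor depending on u times linear functions of h ([net_pairing]); so left
multiplications preserve directions, and the directions are the left parallel
classes. *)

Set Implicit Arguments.
Unset Strict Implicit.
Unset Printing Implicit Defensive.

Import GRing.Theory.
Local Open Scope ring_scope.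

(** * Lines of a projective space *)

Section VectorIdentities.
Variables (F : fieldType) (V : vectType F).

(** Turns identities between linear combinations of vectors into identities of
scalars, which [vector_ring] leaves to [ring]. *)
Lemma eq_by_functionals (x y : V) :
  (forall phi : {scalar V}, phi x = phi y) -> x = y.
Proof.
move=> eq_xy; rewrite (coord_vbasis (memvf x)) (coord_vbasis (memvf y)).
by apply: eq_bigr => i _; congr (_ *: _); apply: eq_xy.
Qed.

Lemma vlineP2 (u v x : V) :
  reflect (exists a b, x = a *: u + b *: v) (x \in <[u]> + <[v]>)%VS.
Proof.
apply: (iffP memv_addP) => [[y /vlineP[a ->] [z /vlineP[b ->] ->]]|[a [b ->]]].
  by exists a, b.
by exists (a *: u); rewrite ?memvZ ?memv_line//; exists (b *: v); rewrite ?memvZ ?memv_line.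
Qed.

Lemma dim_vline2 (u v : V) : u != 0 -> v \notin <[u]>%VS ->
  \dim (<[u]> + <[v]>)%VS = 2%N.
Proof.
move=> u0 vu; have v0 : v != 0 by apply: contraNneq vu => ->; rewrite mem0v.
have := dimv_sum_cap <[u]>%VS <[v]>%VS; rewrite !dim_vline u0 v0.
suff -> : (<[u]> :&: <[v]>)%VS = 0%VS by rewrite dimv0 addn0.
apply/eqP; rewrite -subv0; apply/subvP=> x; rewrite memv_cap memv0.
case/andP=> xu /vlineP[b eqx]; apply: contraNT vu => x0.
have b0 : b != 0 by apply: contraNneq x0 => b0; rewrite eqx b0 scale0r.
by rewrite -[v](scalerK b0) -eqx memvZ.
Qed.

Lemma eq_vline (u v : V) : v != 0 -> v \in <[u]>%VS -> <[u]>%VS = <[v]>%VS.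
Proof.
move=> v0 /vlineP[a eqv].
have a0 : a != 0 by apply: contraNneq v0 => a0; rewrite eqv a0 scale0r.
apply: subv_anti; rewrite -!memvE eqv memvZ ?memv_line//.
by rewrite -{1}[u](scalerK a0) memvZ ?memv_line.
Qed.

Lemma line_basis (u v : V) : u != 0 -> v \notin <[u]>%VS ->
  basis_of (<[u]> + <[v]>)%VS [:: u; v].
Proof.
by move=> u0 vu; rewrite basisEdim span_cons span_seq1 subvv dim_vline2.
Qed.

Lemma span_line (u v : V) : u != 0 -> v \notin <[u]>%VS ->
  exists M : line V, val M = (<[u]> + <[v]>)%VS.
Proof.
move=> u0 vu; have d := dim_vline2 u0 vu.
by exists (exist (fun M : {vspace V} => \dim M == 2%N) _ (introT eqP d)).
Qed.

Lemma line_through (M : line V) (u : V) : u != 0 -> u \in val M ->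
  exists v, v \notin <[u]>%VS /\ val M = (<[u]> + <[v]>)%VS.
Proof.
move=> u0 uM; have dM : \dim (val M) = 2%N by apply/eqP/(valP M).
have : ~~ (val M <= <[u]>)%VS.
  by apply/negP=> /dimvS; rewrite dM dim_vline u0.
case/subvPn=> v vM vu; exists v; split=> //; apply/esym/eqP.
by rewrite eqEdim subv_add -!memvE uM vM dM dim_vline2.
Qed.

Lemma line_generators (M : line V) : exists u v,
  [/\ u != 0, v \notin <[u]>%VS & val M = (<[u]> + <[v]>)%VS].
Proof.
have dM : \dim (val M) = 2%N by apply/eqP/(valP M).
have u0 : vpick (val M) != 0 by rewrite vpick0 -dimv_eq0 dM.
by have [v [vu eM]] := line_through u0 (memv_pick _); exists (vpick (val M)), v.
Qed.

End VectorIdentities.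

Ltac vector_ring := apply: eq_by_functionals => phi;
  rewrite ?(linearD, linearN, linear0, scalarZ, linearZZ) /=; ring.

(** * Bilinear maps *)

Section Bilinear.
Variables (F : fieldType) (V : vectType F) (U : lmodType F) (b : V -> V -> U).
Hypothesis bB : bilinear_map b.

Lemma bilDl x y z : b (x + y) z = b x z + b y z.
Proof. by have := bB.2 z 1 x y; rewrite !scale1r. Qed.

Lemma bilDr x y z : b x (y + z) = b x y + b x z.
Proof. by have := bB.1 x 1 y z; rewrite !scale1r. Qed.

Lemma bil0l z : b 0 z = 0.
Proof. by have := bilDl 0 0 z; rewrite addr0 => /eqP; rewrite addrC -subr_eq subrr => /eqP. Qed.

Lemma bil0r z : b z 0 = 0.
Proof. by have := bilDr z 0 0; rewrite addr0 => /eqP; rewrite addrC -subr_eq subrr => /eqP. Qed.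

Lemma bilZl a x z : b (a *: x) z = a *: b x z.
Proof. by have := bB.2 z a x 0; rewrite !addr0 bil0l addr0. Qed.

Lemma bilZr a x z : b x (a *: z) = a *: b x z.
Proof. by have := bB.1 x a z 0; rewrite !addr0 bil0r addr0. Qed.

Lemma bilNl x z : b (- x) z = - b x z.
Proof. by rewrite -(scaleN1r x) bilZl scaleN1r. Qed.

Lemma bilNr x z : b x (- z) = - b x z.
Proof. by rewrite -(scaleN1r z) bilZr scaleN1r. Qed.

End Bilinear.

Lemma altxx (F : fieldType) (V : vectType F) (U : lmodType F) (b : V -> V -> U) x :
  alternating_map b -> b x x = 0.
Proof. by case. Qed.

Lemma linfun_bilr (F : fieldType) (V Q : vectType F) (b : V -> V -> Q) x y :
  bilinear_map b -> linfun (b x) y = b x y.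
Proof.
move=> bB.
pose f : {linear V -> Q} := HB.pack (b x) (GRing.isLinear.Build _ _ _ _ _ (bB.1 x)).
exact: (lfunE f y).
Qed.

Lemma linfun_bill (F : fieldType) (V Q : vectType F) (b : V -> V -> Q) x y :
  bilinear_map b -> linfun (b^~ y) x = b x y.
Proof.
move=> bB.
pose f : {linear V -> Q} := HB.pack (b^~ y) (GRing.isLinear.Build _ _ _ _ _ (bB.2 y)).
exact: (lfunE f x).
Qed.

(** * Direction maps and their parallelisms *)

Section DirectionMaps.
Variables (F : fieldType) (V Q : vectType F).

Definition line_faithful (b : V -> V -> Q) : Prop :=
  forall x y, x != 0 -> b x y = 0 -> y \in <[x]>%VS.

(** The map u, v |-> b u v gives each line <[u]> + <[v]> of P(V) the point
<[b u v]> of the projective plane P(K) as its direction. *)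
Definition direction_map (K : {vspace Q}) (b : V -> V -> Q) : Prop :=
  [/\ alternating_map b, line_faithful b, \dim K = 3%N & forall x y, b x y \in K].

Lemma plucker_gen (b : V -> V -> Q) (M : line V) u v : alternating_map b ->
  u != 0 -> v \notin <[u]>%VS -> val M = (<[u]> + <[v]>)%VS ->
  plucker b M = <[b u v]>%VS.
Proof.
by move=> bA u0 vu eM; apply: plucker_basis => //; rewrite eM; apply: line_basis.
Qed.

Lemma faithful_rank (b : V -> V -> Q) x : \dim {:V} = 4%N ->
  alternating_map b -> line_faithful b -> x != 0 -> \dim (limg (linfun (b x))) = 3%N.
Proof.
move=> V4 [bB b0] bF x0; have := limg_ker_dim (linfun (b x)) fullv.
have -> : lker (linfun (b x)) = <[x]>%VS.
  apply/vspaceP=> y; rewrite memv_ker linfun_bilr//.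
  apply/eqP/idP=> [|/vlineP[a ->]]; first exact: bF.
  by rewrite (bilZr bB) b0 scaler0.
by rewrite capfv dim_vline x0 V4 => /eqP; rewrite add1n eqSS => /eqP.
Qed.

Variables (K : {vspace Q}) (b : V -> V -> Q).
Hypotheses (V4 : \dim {:V} = 4%N) (bK : direction_map K b).

Lemma direction_neq0 x y : x != 0 -> y \notin <[x]>%VS -> b x y != 0.
Proof. by case: bK => _ bF _ _ x0; apply: contraNneq => /bF ->. Qed.

(** The kernel of [b x] is the line spanned by x, so its rank is 4 - 1 = \dim K. *)
Lemma direction_surj x z : x != 0 -> z \in K -> exists y, b x y = z.
Proof.
move=> x0 zK; have [bA bF dK bin] := bK.
have : limg (linfun (b x)) = K.
  apply/eqP; rewrite eqEdim dK faithful_rank// andbT.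
  by apply/subvP=> _ /memv_imgP[y _ ->]; rewrite linfun_bilr//; apply: bA.1.
move=> eK; move: zK; rewrite -eK => /memv_imgP[y _ ->]; exists y.
by rewrite linfun_bilr//; apply: bA.1.
Qed.

(** If b x z = a * b x y, then b x vanishes at z - a y, which is thus a
multiple of x. *)
Lemma direction_unique x y z : x != 0 -> b x z \in <[b x y]>%VS ->
  z \in (<[x]> + <[y]>)%VS.
Proof.
have [[bB b0] bF _ _] := bK; move=> x0 /vlineP[a e].
have : z - a *: y \in <[x]>%VS.
  by apply: bF => //; rewrite bilDr// bilNr// bilZr// e subrr.
case/vlineP=> c ec; apply/vlineP2; exists c, a.
by rewrite -ec subrK.
Qed.

(** For a direction map [b], [plucker b M] is the direction of M. *)
Definition same_direction (M N : line V) : Prop := plucker b M = plucker b N.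

Lemma same_direction_unique (X : Defs.point V) (L : line V) :
  exists! M : line V, same_direction L M /\ (val X <= val M)%VS.
Proof.
have [bA bF dK bin] := bK.
have X0 : vpick (val X) != 0 by rewrite vpick0 -dimv_eq0 (eqP (valP X)).
set x := vpick (val X) in X0.
have eX : val X = <[x]>%VS.
  by apply/esym/eqP; rewrite eqEdim -memvE memv_pick dim_vline X0 (eqP (valP X)).
have [u [v [u0 vu eL]]] := line_generators L.
have [y ey] := direction_surj X0 (bin u v).
have yx : y \notin <[x]>%VS.
  apply: contraNN (direction_neq0 u0 vu) => /vlineP[a eya].
  by rewrite -ey eya bilZr ?bA.2 ?scaler0//; exact: bA.1.
have [M eM] := span_line X0 yx; exists M; split.
  rewrite /same_direction (plucker_gen bA u0 vu eL) (plucker_gen bA X0 yx eM) ey.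
  by split=> //; rewrite eM eX addvSl.
move=> N [+ XN]; have xN : x \in val N by apply: (subvP XN); rewrite eX memv_line.
have [z [zx eN]] := line_through X0 xN.
rewrite /same_direction (plucker_gen bA u0 vu eL) (plucker_gen bA X0 zx eN) -ey.
move=> e; apply: val_inj; rewrite eM eN; apply/eqP.
rewrite eq_sym eqEdim !dim_vline2// subv_add addvSl -memvE.
by rewrite andbT direction_unique// e memv_line.
Qed.

Lemma same_direction_parallelism : is_parallelism same_direction.
Proof.
split; last exact: same_direction_unique.
by split=> [M|M N|M N P]; rewrite /same_direction // => -> .
Qed.

(** Two lines through a common point have the same direction only if they are
equal; so a relation finer than [same_direction] coincides with it as soon as it
provides a related line through each point. *)
Lemma same_direction_exhausted (P : line V -> line V -> Prop) :
  (forall M N, P M N -> same_direction M N) ->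
  (forall M x, x != 0 -> exists N, P M N /\ x \in val N) ->
  forall M N, same_direction M N <-> P M N.
Proof.
move=> PS Pex M N; split=> [sMN|]; last exact: PS.
have N0 : vpick (val N) != 0 by rewrite vpick0 -dimv_eq0 (eqP (valP N)).
have [N' [PN' xN']] := Pex M _ N0.
have dX : \dim <[vpick (val N)]>%VS == 1%N by rewrite dim_vline N0.
have [L [_ uL]] := same_direction_unique (exist (fun X : {vspace V} => \dim X == 1%N) _ dX) M.
have eN : L = N by apply: uL; split; rewrite //= -memvE memv_pick.
have eN' : L = N' by apply: uL; split; [exact: PS | rewrite /= -memvE].
by rewrite -eN eN'.
Qed.

End DirectionMaps.

(** * Rigidity of direction maps *)

Section Rigidity.
Variables (F : fieldType) (V Q : vectType F) (K : {vspace Q}) (b b' : V -> V -> Q).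
Hypotheses (V4 : \dim {:V} = 4%N) (bK : direction_map K b) (bK' : direction_map K b').
Hypothesis same_b : forall M N : line V, same_direction b M N <-> same_direction b' M N.
Variable e : V.
Hypotheses (e0 : e != 0) (be : forall x, b e x = b' e x).

(** The value b u v is also b e x for some x, and b e x = b' e x: the lines
through u, v and through e, x have the same direction for b, hence for b'. *)
Lemma direction_proportional u v : u != 0 -> v \notin <[u]>%VS ->
  exists a, b' u v = a *: b u v.
Proof.
move=> u0 vu; apply/vlineP; have [bA bF dK bin] := bK; have [bA' _ _ _] := bK'.
have [x ex] := direction_surj V4 bK e0 (bin u v).
have xe : x \notin <[e]>%VS.
  apply: contraNN (direction_neq0 bK u0 vu) => /vlineP[a eya].
  by rewrite -ex eya bilZr ?bA.2 ?scaler0//; exact: bA.1.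
have [M eM] := span_line u0 vu; have [N eN] := span_line e0 xe.
have: same_direction b M N.
  by rewrite /same_direction (plucker_gen bA u0 vu eM) (plucker_gen bA e0 xe eN) ex.
move/same_b; rewrite /same_direction (plucker_gen bA' u0 vu eM).
by rewrite (plucker_gen bA' e0 xe eN) -be ex => <-; apply: memv_line.
Qed.

(** If e lies on the line through u and v, then b u v is a multiple of some
b e z with z in that line, and likewise for b'.
Otherwise b' u (v + e) is proportional to b u (v + e) = b u v + b u e, while
b' u e = b u e, and b u v, b u e are independent: the factor at (u, v) is 1. *)
Lemma direction_rigid u v : b u v = b' u v.
Proof.
have [bA bF dK bin] := bK; have [bA' bF' _ _] := bK'.
have [bB bB'] := (bA.1, bA'.1).
have [->|u0] := eqVneq u 0; first by rewrite !bil0l.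
have [/vlineP[a ->]|vu] := boolP (v \in <[u]>%VS).
  by rewrite (bilZr bB) (bilZr bB') !altxx.
have [/vlineP2[x [y exy]]|euv] := boolP (e \in <[u]> + <[v]>)%VS.
  have [y0|y0] := eqVneq y 0.
    have x0 : x != 0 by apply: contraNneq e0 => x0; rewrite exy x0 y0 !scale0r addr0.
    have := be v; rewrite exy y0 scale0r addr0 (bilZl bB) (bilZl bB').
    exact: (scalerI x0).
  have := be u; rewrite exy (bilDl bB) (bilDl bB') (bilZl bB) (bilZl bB') !altxx// !scaler0 !add0r.
  rewrite (bilZl bB) (bilZl bB').
  move/(scalerI y0); rewrite (alternating_mapC bA) (alternating_mapC bA').
  exact: oppr_inj.
have eu : e \notin <[u]>%VS by apply: contraNN euv => /(subvP (addvSl _ _)).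
have veu : v + e \notin <[u]>%VS.
  apply: contraNN euv => /vlineP[a eva]; apply/vlineP2; exists a, (-1).
  by rewrite -eva scaleN1r addrC addKr.
(* The claim is l1 = 1; comparing both sides of E2 gives l2 = 1 and l1 = l2. *)
have [l1 E1] := direction_proportional u0 vu.
have [l2 E2] := direction_proportional u0 veu.
have bue : b' u e = b u e.
  by rewrite (alternating_mapC bA) (alternating_mapC bA') be.
have : b u ((l1 - l2) *: v + (1 - l2) *: e) = 0.
  move: E2; rewrite (bilDr bB') !(bilDr bB) !(bilZr bB) E1 bue => /eqP.
  rewrite -subr_eq0 => /eqP E2.
  by rewrite -[RHS]E2; vector_ring.
move=> /(bF _ _ u0)/vlineP[a E3].
have l2E : 1 - l2 = 0.
  apply: contraNeq euv => l20; apply/vlineP2.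
  exists ((1 - l2)^-1 * a), (- ((1 - l2)^-1 * (l1 - l2))).
  apply: (scalerI l20); rewrite scalerDr !scalerA mulrN !mulrA divff// !mul1r -E3.
  by rewrite scaleNr addrAC subrr add0r.
move/eqP: E3; rewrite l2E scale0r addr0 => /eqP E3.
move/eqP: l2E; rewrite subr_eq0 => /eqP l2E.
have l12 : l1 - l2 = 0.
  apply: contraNeq vu => l120; apply/vlineP; exists ((l1 - l2)^-1 * a).
  by rewrite -scalerA -E3 scalerK.
by move/eqP: l12; rewrite subr_eq0 => /eqP l12; rewrite E1 l12 -l2E scale1r.
Qed.

End Rigidity.

(** * The exterior square of a 4-dimensional space *)

Section ExteriorSquareTheory.
Variables (F : fieldType) (V W : vectType F) (w : V -> V -> W).
Hypothesis hw : is_exterior_square w.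

Lemma exterior_square_ext (U : vectType F) (g h : 'Hom(W, U)) :
  (forall x y, g (w x y) = h (w x y)) -> g = h.
Proof.
move=> gh; have [wA univ] := hw; have wB := wA.1.
have bA : alternating_map (fun x y => g (w x y)).
  split; last by move=> x; rewrite altxx// linear0.
  split=> x a y z; first by rewrite (bilDr wB) (bilZr wB) linearP.
  by rewrite (bilDl wB) (bilZl wB) linearP.
have [f [_ fu]] := univ _ _ bA.
by apply/lfunP=> x; rewrite (fu g)// (fu h).
Qed.

(** The projection onto X agrees with the identity on all products w x y. *)
Lemma exterior_square_span (X : {vspace W}) : (forall x y, w x y \in X) -> X = fullv.
Proof.
move=> wX; suff : projv X = \1%VF.
  move=> e; apply/eqP; rewrite eqEsubv subvf; apply/subvP=> x _.
  by rewrite -[x](id_lfunE) -e memv_proj.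
by apply: exterior_square_ext => x y; rewrite projv_id// id_lfunE.
Qed.

Section Coordinates.
Variables (n : nat) (e : n.-tuple V).
Hypothesis eV : basis_of {:V} e.

(** The 2 x 2 minors of the coordinates of x and y, an alternating map that
factors through the exterior square and separates independent pairs. *)
Definition minors (x y : V) : 'M[F]_n :=
  \matrix_(i, j) (coord e i x * coord e j y - coord e i y * coord e j x).

Lemma minors_alternating : alternating_map minors.
Proof.
split; last by move=> x; apply/matrixP=> i j; rewrite !mxE subrr.
by split=> x a y z; apply/matrixP=> i j; rewrite !mxE !linearP /=; ring.
Qed.

Lemma minors_eq0 x y : x != 0 -> minors x y = 0 -> y \in <[x]>%VS.
Proof.
move=> x0 /matrixP xy0.
have [i xi] : exists i, coord e i x != 0.
  apply/existsP; apply: contraNT x0; rewrite negb_exists => /forallP xi.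
  rewrite (coord_basis eV (memvf x)) big1// => i _.
  by rewrite (eqP (negbNE (xi i))) scale0r.
apply/vlineP; pose a := coord e i y / coord e i x; exists a.
rewrite [in LHS](coord_basis eV (memvf y)) [in RHS](coord_basis eV (memvf x)).
rewrite scaler_sumr; apply: eq_bigr => j _; rewrite scalerA; congr (_ *: _).
apply: (mulfI xi); have /eqP := xy0 i j.
by rewrite !mxE subr_eq0 => /eqP ->; rewrite /a; field.
Qed.

End Coordinates.

Lemma exterior_square_faithful : line_faithful w.
Proof.
move=> x y x0 wxy.
have [f [fw _]] := hw.2 _ _ (minors_alternating (vbasis {:V})).
by apply: (minors_eq0 (vbasisP _)) x0 _; rewrite -fw wxy linear0.
Qed.

(** The six products of a basis of V span by bilinearity and are independent
because their images under the minors are. *)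
Lemma exterior_square_dim : \dim {:V} = 4%N -> \dim {:W} = 6%N.
Proof.
move=> V4; have [e eV] : exists e : 4.-tuple V, basis_of {:V} e.
  by rewrite -V4; exists (vbasis {:V}); apply: vbasisP.
have wA := hw.1; have [f [fw _]] := hw.2 _ _ (minors_alternating e).
pose X := [tuple w e`_0 e`_1; w e`_0 e`_2; w e`_0 e`_3;
  w e`_1 e`_2; w e`_1 e`_3; w e`_2 e`_3].
have XW : <<X>>%VS = fullv.
  apply: exterior_square_span => x y.
  have Xin u : u \in X -> u \in <<X>>%VS by apply: memv_span.
  have wC u v : w u v \in <<X>>%VS -> w v u \in <<X>>%VS.
    by rewrite (alternating_mapC wA u v) rpredN.
  rewrite (coord_basis eV (memvf x)) (coord_basis eV (memvf y)).
  rewrite (bilinear_map_suml wA.1); apply: rpred_sum => i _; apply: rpredZ.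
  rewrite (bilinear_map_sumr wA.1); apply: rpred_sum => j _; apply: rpredZ.
  case: i => -[|[|[|[|[]]]]] //= _; case: j => -[|[|[|[|[]]]]] //= _;
    rewrite ?(altxx _ wA) ?mem0v//;
    by [apply: Xin; rewrite !inE eqxx ?orbT
       |apply: wC; apply: Xin; rewrite !inE eqxx ?orbT].
have Xf : free X.
  apply/freeP => k; rewrite !big_ord_recl big_ord0 => /(congr1 f).
  rewrite linear0 !linearD !linearZ linear0 /= !fw => /matrixP E.
  have ce p q (p4 : (p < 4)%N) (q4 : (q < 4)%N) :
    coord e (Ordinal p4) e`_q = (q == p)%:R.
    by rewrite (coord_free (Ordinal q4)) ?(basis_free eV).
  have Epq p q (p4 : (p < 4)%N) (q4 : (q < 4)%N) := E (Ordinal p4) (Ordinal q4).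
  have k0 := Epq 0%N 1%N isT isT; have k1 := Epq 0%N 2%N isT isT.
  have k2 := Epq 0%N 3%N isT isT; have k3 := Epq 1%N 2%N isT isT.
  have k4 := Epq 1%N 3%N isT isT; have k5 := Epq 2%N 3%N isT isT.
  move: k0 k1 k2 k3 k4 k5; rewrite !mxE !ce //=.
  rewrite !(mul0r, mulr0, mul1r, mulr1, oppr0, addr0, add0r).
  move=> k0 k1 k2 k3 k4 k5 [[|[|[|[|[|[|[]]]]]]] //= lti].
  - by rewrite -[RHS]k0; congr k; apply: val_inj.
  - by rewrite -[RHS]k1; congr k; apply: val_inj.
  - by rewrite -[RHS]k2; congr k; apply: val_inj.
  - by rewrite -[RHS]k3; congr k; apply: val_inj.
  - by rewrite -[RHS]k4; congr k; apply: val_inj.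
  - by rewrite -[RHS]k5; congr k; apply: val_inj.
by rewrite -XW; apply/eqP; rewrite -[X in _ == X]/(size X); apply: Xf.
Qed.

End ExteriorSquareTheory.

(** * External planes and direction maps *)

Section ExternalPlanes.
Variables (F : fieldType) (V W : vectType F) (w : V -> V -> W).
Hypotheses (V4 : \dim {:V} = 4%N) (hw : is_exterior_square w).

(** Joining with [lker f] amounts to taking images under f. *)
Lemma par_plane_lker (Q : vectType F) (f : 'Hom(W, Q)) M N :
  par_plane w (lker f) M N <-> same_direction (fun x y => f (w x y)) M N.
Proof.
have fker : (f @: lker f)%VS = 0%VS by apply/eqP; rewrite -lkerE subvv.
have sub A B : (f @: A <= f @: B)%VS -> (A <= lker f + B)%VS.
  move=> fAB; apply/subvP=> a aA.
  have /memv_imgP[c cB fa] := subvP fAB _ (memv_img f aA).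
  by rewrite -[a](subrK c) memv_add// memv_ker linearB /= fa subrr.
rewrite /same_direction /plucker -!limg_line -!/(plucker w _); split.
  by move/(congr1 (fun X => f @: X)%VS); rewrite !limgD fker !add0v.
move=> e; apply: subv_anti; rewrite !subv_add !addvSl /=.
by rewrite !sub// e subvv.
Qed.

Lemma external_notin C x y : external_plane w C ->
  x != 0 -> y \notin <[x]>%VS -> w x y \notin C.
Proof.
move=> [_ extC] x0 yx; apply/negP=> wC.
have w0 : w x y != 0 by apply: contraNneq yx; apply: exterior_square_faithful.
have dX : \dim <[w x y]>%VS == 1%N by rewrite dim_vline w0.
have [M eM] := span_line x0 yx.
apply: (extC (exist (fun X : {vspace W} => \dim X == 1%N) _ dX)); first by rewrite /= -memvE.
by exists M => //=; rewrite (plucker_gen hw.1 x0 yx eM).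
Qed.

(** The space w e V consists of 0 and of vectors that span points of the
quadric, so it meets C trivially, and 3 + 3 = 6. The projection fixes w e V
pointwise whatever C is, which gives all external planes direction maps that
agree at e. *)
Lemma external_projection C e : external_plane w C -> e != 0 ->
  exists p : 'Hom(W, W), [/\ lker p = C, forall x, p (w e x) = w e x &
    direction_map (limg (linfun (w e))) (fun x y => p (w x y))].
Proof.
move=> extC e0; have wA := hw.1; have wB := wA.1.
set U := limg _; exists (daddv_pi U C).
have dU : \dim U = 3%N by apply: faithful_rank => //; apply: exterior_square_faithful.
have UC : (U :&: C)%VS = 0%VS.
  apply/eqP; rewrite -subv0; apply/subvP=> z; rewrite memv_cap memv0.
  case/andP=> /memv_imgP[x _ ->]; rewrite linfun_bilr// => wC.
  have [/vlineP[a ->]|xe] := boolP (x \in <[e]>%VS).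
    by rewrite (bilZr wB) (altxx _ wA) scaler0.
  by rewrite (negbTE (external_notin extC e0 xe)) in wC.
have UCf : (U + C)%VS = fullv.
  apply/eqP; rewrite eqEdim subvf (exterior_square_dim hw)//.
  by rewrite dimv_disjoint_sum// dU extC.1.
have pE z : daddv_pi U C z + daddv_pi C U z = z.
  by rewrite daddv_pi_add// UCf memvf.
have kp : lker (daddv_pi U C) = C.
  apply/vspaceP=> z; rewrite memv_ker; apply/eqP/idP=> [p0|zC].
    by rewrite -(pE z) p0 add0r memv_pi.
  apply: (addIr (daddv_pi C U z)); rewrite pE add0r daddv_pi_id//.
  by rewrite capvC.
split=> //.
  move=> x; rewrite daddv_pi_id//.
  by apply/memv_imgP; exists x; rewrite ?memvf// linfun_bilr.
split=> //; last by move=> x y; rewrite memv_pi.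
  split; last by move=> x; rewrite (altxx _ wA) linear0.
  split=> x a y z; first by rewrite (bilDr wB) (bilZr wB) linearP.
  by rewrite (bilDl wB) (bilZl wB) linearP.
move=> x y x0 /eqP; rewrite -memv_ker kp; apply: contraTT.
exact: external_notin.
Qed.

(** The plane is the kernel of the linear map induced on the exterior square,
whose image is K; a point of the quadric in it would be a product w x y of
independent vectors with b x y = 0. *)
Lemma direction_map_external (Q : vectType F) (K : {vspace Q}) (b : V -> V -> Q) :
  direction_map K b -> exists C, external_plane w C /\
    forall M N, par_plane w C M N <-> same_direction b M N.
Proof.
move=> [bA bF dK bin]; have [g [gw _]] := hw.2 _ _ bA.
pose f := linfun g; have fw x y : f (w x y) = b x y by rewrite lfunE /= gw.
have e0 : vpick {:V} != 0 by rewrite vpick0 -dimv_eq0 V4.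
have fK : limg f = K.
  apply: subv_anti; apply/andP; split; apply/subvP=> z.
    case/memv_imgP=> x _ ->; rewrite memv_preim.
    rewrite (exterior_square_span hw (X := (f @^-1: K)%VS)) ?memvf// => u v.
    by rewrite -memv_preim fw.
  have bK : direction_map K b by [].
  by case/(direction_surj V4 bK e0)=> y <-; rewrite -fw memv_img// memvf.
exists (lker f); split; last first.
  move=> M N; apply: (iff_trans (par_plane_lker f M N)).
  by rewrite /same_direction /plucker !fw.
split.
  have := limg_ker_dim f fullv.
  by rewrite capfv fK dK (exterior_square_dim hw V4) => /eqP; rewrite (eqn_add2r 3 _ 3) => /eqP.
move=> X XC [M _ eX].
have [x [y [x0 yx eM]]] := line_generators M.
have : w x y \in lker f.
  by apply: (subvP XC); rewrite -eX (plucker_gen hw.1 x0 yx eM) memv_line.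
rewrite memv_ker fw => /eqP /(bF _ _ x0) yx'.
by rewrite yx' in yx.
Qed.

End ExternalPlanes.

(** * Skew fields of dimension 4 and the quaternion trace *)

Section SkewFields.
Variables (F : fieldType) (V : vectType F) (H : algebra_on V).
Hypothesis Hsf : is_skew_field H.

Local Notation "x ** y" := (amul H x y) (at level 40, left associativity).
Local Notation "1H" := (aone H).
Let mB := amul_bilinear H.
Let mA := @amulA F V H.

Lemma aone_neq0 : 1H != 0. Proof. exact/eqP/Hsf.1. Qed.

Lemma amulfI x y z : x != 0 -> x ** y = x ** z -> y = z.
Proof.
move=> x0 e; have [x' [_ x'x]] := Hsf.2 x (elimN eqP x0).
by rewrite -[y](amul1l H) -x'x -mA e mA x'x amul1l.
Qed.

Lemma amulIf x y z : x != 0 -> y ** x = z ** x -> y = z.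
Proof.
move=> x0 e; have [x' [xx' _]] := Hsf.2 x (elimN eqP x0).
by rewrite -[y](amul1r H) -xx' mA e -mA xx' amul1r.
Qed.

Lemma amulf_neq0 x y : x != 0 -> y != 0 -> x ** y != 0.
Proof.
by move=> x0; apply: contraNneq => e; apply/eqP; apply: (amulfI x0); rewrite e (bil0r mB).
Qed.

Lemma amulf_div x y : x != 0 -> y != 0 -> exists c, c != 0 /\ c ** x = y.
Proof.
move=> x0 y0; have [x' [_ x'x]] := Hsf.2 x (elimN eqP x0); exists (y ** x').
have e : y ** x' ** x = y by rewrite -mA x'x amul1r.
by split=> //; apply: contraNneq y0 => c0; rewrite -e c0 (bil0l mB).
Qed.

Lemma amul_notin_line c u v : c != 0 -> v \notin <[u]>%VS -> c ** v \notin <[c ** u]>%VS.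
Proof.
move=> c0; apply: contraNN => /vlineP[a e]; apply/vlineP; exists a.
by apply: (amulfI c0); rewrite e (bilZr mB).
Qed.

Lemma limg_amul c u v :
  (linfun (amul H c) @: (<[u]> + <[v]>) = <[c ** u]> + <[c ** v]>)%VS.
Proof. by rewrite limgD !limg_line !(linfun_bilr _ _ mB). Qed.

Lemma left_parallel_cover (M : line V) x : x != 0 ->
  exists N, left_parallel H M N /\ x \in val N.
Proof.
move=> x0; have [u [v [u0 vu eM]]] := line_generators M.
have [c [c0 cu]] := amulf_div u0 x0.
have [N eN] := span_line (amulf_neq0 c0 u0) (amul_notin_line c0 vu).
exists N; split; first by exists c; split; [exact/eqP | rewrite eM limg_amul eN].
by rewrite eN cu (subvP (addvSl _ _)) ?memv_line.
Qed.

(** The centralizer C of x is a division algebra that omits y, so C and C y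
meet trivially and \dim C is at most 2; it contains 1 and x. *)
Lemma centralizer_dim2 x y z : \dim {:V} = 4%N -> x ** y <> y ** x ->
  z ** x = x ** z -> z \in (<[1H]> + <[x]>)%VS.
Proof.
move=> V4 xy zx; pose C := lker (linfun ((amul H)^~ x) - linfun (amul H x)).
have inC u : (u \in C) = (u ** x == x ** u).
  by rewrite memv_ker add_lfunE opp_lfunE (linfun_bill _ _ mB) (linfun_bilr _ _ mB) subr_eq0.
have y0 : y != 0 by apply/eqP=> y0; apply: xy; rewrite y0 (bil0l mB) (bil0r mB).
pose R := linfun ((amul H)^~ y).
have RE u : R u = u ** y by rewrite (linfun_bill _ _ mB).
have CRC : (C :&: (R @: C))%VS = 0%VS.
  apply/eqP; rewrite -subv0; apply/subvP=> a; rewrite memv_cap memv0.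
  case/andP=> + /memv_imgP[b]; rewrite !inC => /eqP aC /eqP bC eab.
  rewrite eab RE in aC *; have [->|b0] := eqVneq b 0; first by rewrite (bil0l mB).
  by case: xy; apply: (amulfI b0); rewrite mA bC -mA -aC mA.
have dRC : \dim (R @: C)%VS = \dim C.
  apply: limg_dim_eq; apply/eqP; rewrite -subv0; apply/subvP=> a; rewrite memv_cap memv0.
  rewrite memv_ker RE => /andP[_]; apply: contraTT => a0; exact: amulf_neq0.
have x1 : x \notin <[1H]>%VS.
  by apply/vlineP=> -[a e]; apply: xy; rewrite e (bilZl mB) (bilZr mB) amul1l amul1r.
have sC : (<[1H]> + <[x]> <= C)%VS.
  by rewrite subv_add -!memvE !inC amul1l amul1r !eqxx.
suff -> : (<[1H]> + <[x]>)%VS = C by rewrite inC zx.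
apply/eqP; rewrite eqEdim sC dim_vline2 ?aone_neq0//=.
have := dimvS (subvf (C + R @: C)); rewrite dimv_disjoint_sum// dRC V4.
by rewrite addnn -[4%N]/(2.*2) leq_double.
Qed.

End SkewFields.

Section QuaternionConjugation.
Variables (F : fieldType) (V : vectType F) (H : algebra_on V).

Local Notation "x ** y" := (amul H x y) (at level 40, left associativity).
Local Notation "1H" := (aone H).
Let mB := amul_bilinear H.
Let mA := @amulA F V H.

Lemma vline2_coef x a b c d : x \notin <[1H]>%VS ->
  a *: 1H + b *: x = c *: 1H + d *: x -> b = d.
Proof.
move=> x1 e; apply/eqP; rewrite -subr_eq0; apply: contraNT x1 => bd.
apply/vlineP; exists ((b - d)^-1 * (c - a)); apply: (scalerI bd).
rewrite scalerA mulVKf//; apply: (addrI (a *: 1H + d *: x)).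
have -> : a *: 1H + d *: x + (b - d) *: x = a *: 1H + b *: x by vector_ring.
by rewrite e; vector_ring.
Qed.

Hypothesis Hq : is_quaternion_skew_field H.

Let Hsf : is_skew_field H. Proof. by case: Hq. Qed.
Let V4 : \dim {:V} = 4%N. Proof. by case: Hq. Qed.

Lemma quaternion_quadratic x y : x ** y <> y ** x ->
  exists n t, x ** x = n *: 1H + t *: x.
Proof. by move=> xy; apply/vlineP2; apply: (centralizer_dim2 Hsf V4 xy). Qed.

(** With x x = n + t x, the element x z + z x - t z commutes with x. *)
Lemma jordan_centralizer x y n t z : x ** y <> y ** x ->
  x ** x = n *: 1H + t *: x ->
  x ** z + z ** x - t *: z \in (<[1H]> + <[x]>)%VS.
Proof.
move=> xy xx; apply: (centralizer_dim2 Hsf V4 xy).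
rewrite !(bilDl mB, bilDr mB, bilNl mB, bilNr mB, bilZl mB, bilZr mB).
rewrite -!mA xx (mA x x z) xx.
rewrite !(bilDl mB, bilDr mB, bilNl mB, bilNr mB, bilZl mB, bilZr mB).
rewrite amul1l amul1r; vector_ring.
Qed.

(** Fix a noncentral x with x x = n + t0 x. For every z, x z + z x - t0 z is in
the span of 1 and x, and its coefficient of x is the trace of z; this
definition is linear from the start and covers characteristic 2. When x and z do not
commute, exchanging their roles gives x z + z x a second expression, and comparing
the two identifies the coefficient with the one in z z = n' + t' z. *)
Lemma quaternion_trace : exists t : {scalar V}, t 1H = 2%:R /\
  forall z, z ** z - t z *: z \in <[1H]>%VS.
Proof.
have [_ Hc _] := Hq.
have : ~~ ({:V} <= <[1H]>)%VS.
  by apply/negP=> /dimvS; rewrite V4 dim_vline; case: eqP.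
case/subvPn=> x _ x1.
have [y xy] : exists y, x ** y <> y ** x.
  apply: contrapT => no; move/negP: x1; apply; apply/Hc => y.
  by apply: contrapT => xy; apply: no; exists y.
have [n [t0 xx]] := quaternion_quadratic xy.
pose E : 'End(V) := linfun (amul H x) + linfun ((amul H)^~ x) - t0 *: \1%VF.
have EE z : E z = x ** z + z ** x - t0 *: z.
  by rewrite !lfun_simp (linfun_bilr _ _ mB) (linfun_bill _ _ mB).
pose X := [tuple 1H; x].
pose t : {scalar V} := HB.pack (fun z => coord X ord_max (E z))
  (GRing.isLinear.Build _ _ _ _ (fun z => coord X ord_max (E z))
   (fun a u v => etrans (congr1 _ (linearP E a u v)) (linearP (coord X ord_max) a _ _))).
have tE z : exists c, E z = c *: 1H + t z *: x.
  have := jordan_centralizer z xy xx.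
  rewrite -EE -(span_seq1 x) -span_cons => /(coord_span (X := X)) ->.
  rewrite big_ord_recl big_ord1 /=; exists (coord X ord0 (E z)); congr (_ + _ *: _).
  by congr (coord X _ _); apply: val_inj.
exists t; split.
  have [c] := tE 1H; rewrite EE amul1l amul1r => e.
  by apply: (vline2_coef (x := x) (a := c) (c := - t0)) => //; rewrite -e; vector_ring.
(* For z = b + a x the value is t z = 2 b + a t0, found by expanding E z. *)
move=> z; have [|z1] := boolP (z \in <[1H]> + <[x]>)%VS.
  case/vlineP2=> b [a ez]; have [c] := tE z; rewrite EE ez.
  rewrite !(bilDl mB, bilDr mB, bilNl mB, bilNr mB, bilZl mB, bilZr mB).
  rewrite amul1l amul1r => e; rewrite xx in e.
  have tz : t (b *: 1H + a *: x) = 2%:R * b + a * t0.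
    apply: (vline2_coef (x := x) (a := c) (c := 2%:R * a * n - t0 * b)) => //.
    by rewrite -e; vector_ring.
  rewrite !(amul1l, amul1r) xx tz.
  apply/vlineP; exists (b * b + a * a * n - (2%:R * b + a * t0) * b).
  by vector_ring.
have zx : z ** x <> x ** z.
  by move=> zx; move/negP: z1; apply; apply: (centralizer_dim2 Hsf V4 xy).
have [n' [t' zz]] := quaternion_quadratic zx.
have [c] := tE z; rewrite EE => e.
have /vlineP2 [c' [t'' e']] := jordan_centralizer x zx zz.
have e3 : (t z - t') *: x + (t0 - t'') *: z = (c' - c) *: 1H.
  have -> : (c' - c) *: 1H = (c' *: 1H + t'' *: z) - (c *: 1H + t z *: x) + (t z *: x - t'' *: z).
    by vector_ring.
  by rewrite -e -e'; vector_ring.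
have t0'' : t0 - t'' = 0.
  apply: contraNeq z1 => d0; apply/vlineP2.
  exists ((t0 - t'')^-1 * (c' - c)), (- ((t0 - t'')^-1 * (t z - t'))).
  apply: (scalerI d0); rewrite scalerDr !scalerA mulrN !mulVKf// -e3.
  by vector_ring.
move: e3; rewrite t0'' scale0r addr0 => e3.
have tz : t z = t'.
  apply/eqP; rewrite -subr_eq0; apply: contraNT x1 => d0.
  by apply/vlineP; exists ((t z - t')^-1 * (c' - c)); rewrite -scalerA -e3 scalerK.
by rewrite zz tz addrK memvZ ?memv_line.
Qed.

End QuaternionConjugation.

(** * Direction maps of the algebras of Clifford parallelisms *)

Section LeftDirections.
Variables (F : fieldType) (V : vectType F) (H : algebra_on V).
Hypotheses (V4 : \dim {:V} = 4%N) (Hsf : is_skew_field H).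

Local Notation "x ** y" := (amul H x y) (at level 40, left associativity).
Local Notation "1H" := (aone H).
Let mB := amul_bilinear H.
Let mA := @amulA F V H.

(** Left multiplications that preserve directions make left parallel lines
parallel, and each line has a left parallel through each point. *)
Lemma same_direction_left_parallel (Q : vectType F) (K : {vspace Q}) (b : V -> V -> Q) :
  direction_map K b ->
  (forall c u v, c != 0 -> u != 0 -> v \notin <[u]>%VS ->
     exists a, b (c ** u) (c ** v) = a *: b u v) ->
  forall M N, same_direction b M N <-> left_parallel H M N.
Proof.
move=> bK bc; have [bA _ _ _] := bK.
apply: (same_direction_exhausted V4 bK) => [M N [c [/eqP c0 eN]]|M x x0]; last first.
  exact: left_parallel_cover.
have [u [v [u0 vu eM]]] := line_generators M.
rewrite eM limg_amul in eN.
have cu0 := amulf_neq0 Hsf c0 u0; have cvu := amul_notin_line Hsf c0 vu.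
rewrite /same_direction (plucker_gen bA u0 vu eM) (plucker_gen bA cu0 cvu (esym eN)).
have [a ea] := bc c u v c0 u0 vu; apply: eq_vline.
  exact: direction_neq0 bK _ _ cu0 cvu.
by rewrite ea memvZ ?memv_line.
Qed.

(** Both s (c u) c u and s u u are scalars, the latter nonzero; cancelling u,
s (c u) c is a scalar multiple of s u, so the values at (c u, c v) and (u, v)
are proportional. *)
Lemma conjugation_direction_map (s : {linear V -> V}) :
  (forall x, s x ** x \in <[1H]>%VS) -> (forall x, x != 0 -> s x != 0) ->
  exists (K : {vspace V}) (b : V -> V -> V), direction_map K b /\
    forall M N, same_direction b M N <-> left_parallel H M N.
Proof.
move=> sx s0; have one0 := aone_neq0 Hsf.
pose p := \1%VF - projv <[1H]>%VS.
have kp : lker p = <[1H]>%VS.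
  apply/vspaceP=> x; rewrite memv_ker add_lfunE opp_lfunE id_lfunE subr_eq0.
  by apply/eqP/idP=> [->|/projv_id]; [apply: memv_proj | move->].
pose b u v := p (s u ** v).
have bK : direction_map (limg p) b.
  split; last by move=> x y; rewrite memv_img ?memvf.
  - split; last by move=> x; apply/eqP; rewrite -memv_ker kp.
    split=> x a y z; rewrite /b.
      by rewrite (bilDr mB) (bilZr mB) linearP.
    by rewrite linearP (bilDl mB) (bilZl mB) linearP.
  - move=> x y x0 /eqP; rewrite -memv_ker kp => /vlineP[m ey].
    have /vlineP[n ex] := sx x.
    have n0 : n != 0.
      apply: contraTneq (amulf_neq0 Hsf (s0 _ x0) x0) => n0.
      by rewrite ex n0 scale0r eqxx.
    apply/vlineP; exists (m / n); apply: (amulfI Hsf (s0 _ x0)).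
    by rewrite (bilZr mB) ex ey scalerA divfK.
  - have := limg_ker_dim p fullv; rewrite capfv kp dim_vline one0 V4.
    by move/eqP; rewrite add1n eqSS => /eqP.
exists (limg p), b; split=> //; apply: (same_direction_left_parallel bK).
move=> c u v c0 u0 vu.
have /vlineP[m em] := sx (c ** u); have /vlineP[n en] := sx u.
have n0 : n != 0.
  apply: contraTneq (amulf_neq0 Hsf (s0 _ u0) u0) => n0.
  by rewrite en n0 scale0r eqxx.
exists (m / n); rewrite /b mA.
have -> : s (c ** u) ** c = (m / n) *: s u.
  apply: (amulIf Hsf u0); rewrite -mA em (bilZl mB) en scalerA divfK//.
by rewrite (bilZl mB) linearZ.
Qed.

(** In a quaternion skew field z |-> t z - z is the conjugation, t being the
trace; in a field whose squares are scalars the identity serves. *)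
Lemma clifford_conjugation :
  is_quaternion_skew_field H \/ is_square_central_quartic_field H ->
  exists s : {linear V -> V},
    (forall x, s x ** x \in <[1H]>%VS) /\ (forall x, x != 0 -> s x != 0).
Proof.
move=> [Hq|[_ _ _ sq]]; last by exists idfun.
have [t [t1 tq]] := quaternion_trace Hq.
pose s0 z := t z *: 1H - z.
have sL : linear s0.
  by move=> a x y; rewrite /s0 linearP /=; vector_ring.
pose s : {linear V -> V} := HB.pack s0 (GRing.isLinear.Build _ _ _ _ s0 sL).
exists s; split=> [x|x].
  rewrite /= /s0 (bilDl mB) (bilNl mB) (bilZl mB) amul1l -opprB rpredN.
  exact: tq.
rewrite /= /s0; apply: contraNneq => /eqP; rewrite subr_eq0 => /eqP e.
have : t x = 2%:R * t x by rewrite -{1}e scalarZ t1 mulrC.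
move/eqP; rewrite -subr_eq0 => /eqP ex.
by rewrite -e (_ : t x = 0) ?scale0r// -[RHS]oppr0 -ex; ring.
Qed.

End LeftDirections.

Definition opposite_algebra (F : fieldType) (V : vectType F) (H : algebra_on V) :
  algebra_on V :=
  @AlgebraOn F V (fun x y => amul H y x) (aone H)
    (conj (amul_bilinear H).2 (amul_bilinear H).1)
    (fun x y z => esym (amulA H z y x)) (amul1r H) (amul1l H).

Lemma opposite_clifford (F : fieldType) (V : vectType F) (H : algebra_on V) :
  is_quaternion_skew_field H \/ is_square_central_quartic_field H ->
  is_quaternion_skew_field (opposite_algebra H) \/
  is_square_central_quartic_field (opposite_algebra H).
Proof.
have sf : is_skew_field H -> is_skew_field (opposite_algebra H).
  by move=> [one0 inv]; split=> // x /inv[y [xy yx]]; exists y.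
case=> [[/sf Hsf Hc V4]|[/sf Hsf mC V4 sq]]; [left|right]; split=> //.
  move=> z; rewrite -Hc; split=> zC x; exact/esym/zC.
by move=> x y; apply: mC.
Qed.

(** * Nets of alternating forms and their operators *)

Section Adjoint.
Variables (F : fieldType) (V : vectType F) (w0 w1 : V -> V -> F^o).

(** Curried, a nondegenerate form is an isomorphism of V with its dual. *)
Lemma form_operator : bilinear_map w0 -> bilinear_map w1 ->
  (forall x, (forall y, w0 x y = 0) -> x = 0) ->
  exists S : 'End(V), forall x y, w0 (S x) y = w1 x y.
Proof.
have curryL w : bilinear_map w -> linear (fun x => linfun (w x) : 'Hom(V, F^o)).
  move=> wB a x y; apply/lfunP=> z; rewrite !lfun_simp !(linfun_bilr _ _ wB).
  by rewrite (bilDl wB) (bilZl wB).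
move=> B0 B1 nd.
pose f0 : {linear V -> 'Hom(V, F^o)} := HB.pack (fun x => linfun (w0 x) : 'Hom(V, F^o))
  (GRing.isLinear.Build _ _ _ _ _ (curryL _ B0)).
pose f1 : {linear V -> 'Hom(V, F^o)} := HB.pack (fun x => linfun (w1 x) : 'Hom(V, F^o))
  (GRing.isLinear.Build _ _ _ _ _ (curryL _ B1)).
have f0E x y : linfun f0 x y = w0 x y by rewrite lfunE /= linfun_bilr.
have f1E x y : linfun f1 x y = w1 x y by rewrite lfunE /= linfun_bilr.
have f0V : limg (linfun f0) = fullv.
  apply/eqP; rewrite eqEdim subvf limg_dim_eq.
    by rewrite !dimvf /= -[X in (X <= _)%N]/(dim V * 1)%N muln1 leqnn.
  rewrite capfv; apply/eqP; rewrite -subv0; apply/subvP=> x; rewrite memv_ker memv0.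
  by move=> /eqP fx; apply/eqP/nd => y; rewrite -f0E fx zero_lfunE.
exists ((linfun f0)^-1 \o linfun f1)%VF => x y.
by rewrite comp_lfunE -f0E limg_lfunVK ?f0V ?memvf.
Qed.

End Adjoint.

Section FormNets.
Variables (F : fieldType) (V : vectType F).

(** The coordinates of a direction map: an independent pair is separated by
one of the forms, and at each x <> 0 the three functionals are independent. *)
Definition form_net (w0 w1 w2 : V -> V -> F^o) : Prop :=
  [/\ [/\ alternating_map w0, alternating_map w1 & alternating_map w2],
      forall x y, x != 0 -> w0 x y = 0 -> w1 x y = 0 -> w2 x y = 0 -> y \in <[x]>%VS
    & forall x a b c, x != 0 ->
        (forall y, a * w0 x y + b * w1 x y + c * w2 x y = 0) -> [/\ a = 0, b = 0 & c = 0]].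

(** Exchanges the roles of S and T. *)
Lemma form_net_swap w0 w1 w2 : form_net w0 w1 w2 -> form_net w0 w2 w1.
Proof.
move=> [[A0 A1 A2] sep nd]; split=> // [x y x0 ? ? ?|x a b c x0 e]; first exact: sep.
have [y|-> -> ->] // := nd x a c b x0.
by rewrite -[RHS](e y); ring.
Qed.

(** Replaces S by S + T, so that [net_quadratic] also applies to the sum and
yields the value of S T + T S. *)
Lemma form_net_shear w0 w1 w2 : form_net w0 w1 w2 ->
  form_net w0 (fun x y => w1 x y + w2 x y) w2.
Proof.
move=> [[A0 A1 A2] sep nd]; split=> [|x y x0 e0 e1 e2|x a b c x0 e].
- split=> //; split; last by move=> x; rewrite (altxx _ A1) (altxx _ A2) addr0.
  have [B1 B2] := (A1.1, A2.1).
  split=> x a y z.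
    by rewrite (bilDr B1) (bilZr B1) (bilDr B2) (bilZr B2) scalerDr addrACA.
  by rewrite (bilDl B1) (bilZl B1) (bilDl B2) (bilZl B2) scalerDr addrACA.
- by apply: sep => //; move: e1; rewrite e2 addr0.
have [y|-> b0 /eqP] // := nd x a b (b + c) x0; last by rewrite b0 add0r => /eqP.
by rewrite -[RHS](e y); ring.
Qed.

Section Quadratic.
Variables (w0 w1 w2 : V -> V -> F^o) (S : 'End(V)).
Hypotheses (net : form_net w0 w1 w2) (Sw : forall x y, w0 (S x) y = w1 x y).

Let A0 : alternating_map w0. Proof. by case: net => -[]. Qed.
Let A1 : alternating_map w1. Proof. by case: net => -[]. Qed.
Let A2 : alternating_map w2. Proof. by case: net => -[]. Qed.

Lemma net_skew x : w0 x (S x) = 0.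
Proof. by rewrite (alternating_mapC A0) Sw (altxx _ A1) oppr0. Qed.

Lemma net_adjoint x y : w0 x (S y) = w0 (S x) y.
Proof. by rewrite (alternating_mapC A0) !Sw -(alternating_mapC A1). Qed.

Lemma net_notin x : x != 0 -> S x \notin <[x]>%VS.
Proof.
move=> x0; apply/negP=> /vlineP[a e]; case: net => _ _ /(_ x (- a) 1 0 x0)[].
  by move=> y; rewrite -Sw e (bilZl A0.1) -[a *: _]/(a * _); ring.
by move=> _ /eqP; rewrite oner_eq0.
Qed.

(** The span of x under all powers of S, by [net_line_stable] below. *)
Definition net_line x := (<[x]> + <[S x]>)%VS.

(** The functionals w0 x and w1 x vanish at x and S x, but w2 x (S x) <> 0; so
subtracting a multiple of S x from y makes all three forms vanish. *)
Lemma net_line_isotropic x y : x != 0 -> w0 x y = 0 -> w1 x y = 0 -> y \in net_line x.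
Proof.
move=> x0 e0 e1; have [_ sep _] := net.
have w1S : w1 x (S x) = 0 by rewrite -Sw (altxx _ A0).
have w2S : w2 x (S x) != 0.
  by apply: contraNneq (net_notin x0) => e2; apply: sep => //; apply: net_skew.
have : y - (w2 x y / w2 x (S x)) *: S x \in <[x]>%VS.
  apply: sep => //.
  - by rewrite (bilDr A0.1) (bilNr A0.1) (bilZr A0.1) e0 net_skew scaler0 subr0.
  - by rewrite (bilDr A1.1) (bilNr A1.1) (bilZr A1.1) e1 w1S scaler0 subr0.
  - by rewrite (bilDr A2.1) (bilNr A2.1) (bilZr A2.1) -[_ *: w2 _ _]/(_ * _) divfK ?subrr.
case/vlineP=> a e; apply/vlineP2; exists a, (w2 x y / w2 x (S x)).
by rewrite -e subrK.
Qed.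

(** As S is self-adjoint and skew for w0, both w0 x and w1 x vanish at S (S x). *)
Lemma net_line_stable x : x != 0 -> S (S x) \in net_line x.
Proof.
move=> x0; apply: net_line_isotropic => //; first by rewrite net_adjoint (altxx _ A0).
by rewrite -Sw net_skew.
Qed.

Lemma net_line_eq x z : x != 0 -> z != 0 -> z \in net_line x -> net_line z = net_line x.
Proof.
move=> x0 z0 zx; apply/eqP; rewrite eqEdim !dim_vline2 ?net_notin// andbT.
rewrite subv_add -!memvE zx; have /vlineP2[a [b ->]] := zx.
rewrite linearD !linearZ /= rpredD// rpredZ ?net_line_stable//.
by rewrite (subvP (addvSr _ _)) ?memv_line.
Qed.

(** Each S (S x) is on the line of x and S x, and the coefficients do not
depend on x: take them from a vector e and let P be S S - s S - n. Then
P x = P (x + e) lies on the S-lines of x and of x + e. If it is nonzero the two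
lines coincide and contain e, so x is on the S-line of e, where P vanishes. *)
Lemma net_quadratic (e : V) : e != 0 ->
  exists s n : F, forall x, S (S x) = s *: S x + n *: x.
Proof.
move=> e0; have /vlineP2[n [s See]] := net_line_stable e0; exists s, n => x.
pose P : 'End(V) := (S \o S - s *: S - n *: \1)%VF.
have PE z : P z = S (S z) - s *: S z - n *: z by rewrite !lfun_simp.
suff Px : P x = 0 by move: Px; rewrite PE => /eqP; rewrite !subr_eq add0r addrC => /eqP.
have PS z : P (S z) = S (P z) by rewrite !PE; vector_ring.
have Pe : P e = 0 by rewrite PE See; vector_ring.
have Pin z : z != 0 -> P z \in net_line z.
  move=> z0; rewrite PE !rpredB ?net_line_stable ?rpredZ//.
    by rewrite (subvP (addvSr _ _)) ?memv_line.
  by rewrite (subvP (addvSl _ _)) ?memv_line.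
apply/eqP; case: (eqVneq (P x) 0) => // Px0.
have x0 : x != 0 by apply: contraNneq Px0 => ->; rewrite linear0.
have Pxe : P (x + e) = P x by rewrite linearD /= Pe addr0.
have xe0 : x + e != 0 by apply: contraNneq Px0 => xe; rewrite -Pxe xe linear0.
have xP := net_line_eq x0 Px0 (Pin _ x0).
have xeP : net_line (P x) = net_line (x + e).
  by apply: net_line_eq; rewrite -?Pxe ?Pin ?Pxe.
have ex : e \in net_line x.
  have -> : e = (x + e) - x by rewrite addrAC subrr add0r.
  rewrite rpredB //; last by rewrite (subvP (addvSl _ _)) ?memv_line.
  by rewrite -xP xeP (subvP (addvSl _ _)) ?memv_line.
have : x \in net_line e.
  by rewrite (net_line_eq x0 e0 ex) (subvP (addvSl _ _)) ?memv_line.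
case/vlineP2=> a [b xE]; case/eqP: Px0.
by rewrite xE linearD !linearZ /= PS Pe !linear0 addr0.
Qed.

End Quadratic.
End FormNets.

(** * The division algebra of a net *)

Section NetAlgebra.
Variables (F : fieldType) (V : vectType F) (w0 w1 w2 : V -> V -> F^o).
Variables (S T : 'End(V)) (s n t m r g : F) (e : V).
Hypotheses (V4 : \dim {:V} = 4%N) (net : form_net w0 w1 w2) (e0 : e != 0).
Hypotheses (Sw : forall x y, w0 (S x) y = w1 x y) (Tw : forall x y, w0 (T x) y = w2 x y).
Hypotheses (SS : forall x, S (S x) = s *: S x + n *: x)
  (TT : forall x, T (T x) = t *: T x + m *: x)
  (TS : forall x, T (S x) = - S (T x) + (r - s) *: S x + (r - t) *: T x + g *: x).

Let A0 : alternating_map w0. Proof. by case: net => -[]. Qed.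

(** A nonzero combination of the three forms is nondegenerate, so the operator
a + b S + c T is injective. *)
Lemma net_free3 x a b c : x != 0 -> a *: x + b *: S x + c *: T x = 0 ->
  [/\ a = 0, b = 0 & c = 0].
Proof.
move=> x0 lin0; have [_ _] := net; apply=> [|y]; first exact: x0.
rewrite -Sw -Tw -!/(_ *: (_ : F^o)) -!(bilZl A0.1) -!(bilDl A0.1) lin0.
exact: bil0l A0.1 _.
Qed.

(** Writing the relation as (a + b S) x + (c + d S) T x = 0, multiplication by the
conjugate (c + d s) - d S of c + d S replaces the last coefficient by the
norm N, and brings the relation into the scope of [net_free3]. A zero norm
forces c = d = 0. *)
Lemma net_free4 x a b c d : x != 0 ->
  a *: x + b *: S x + c *: T x + d *: S (T x) = 0 -> [/\ a = 0, b = 0, c = 0 & d = 0].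
Proof.
move=> x0 lin0; pose N := c * c + c * d * s - d * d * n.
have : (c * a + d * s * a - d * b * n) *: x + (c * b - d * a) *: S x + N *: T x = 0.
  (* (c + d s) - d S is the conjugate of c + d S, with product N. *)
  have := congr1 (fun z => (c + d * s) *: z - d *: S z) lin0.
  rewrite /= !linear0 addr0 => <-.
  by rewrite !linearD !linearZ /= !SS /N; vector_ring.
case/(net_free3 x0)=> _ _ N0.
have cd0 : c *: x + d *: S x + 0 *: T x = 0.
  apply/eqP/contraT => cdx.
  have : N *: x = 0 by rewrite N0 scale0r.
  have -> : N *: x = (c + d * s) *: (c *: x + d *: S x + 0 *: T x)
      + (- d) *: S (c *: x + d *: S x + 0 *: T x).
    by rewrite !linearD !linearZ /= !SS /N; vector_ring.
  move=> Ey; have Ey0 : (c + d * s) *: (c *: x + d *: S x + 0 *: T x)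
      + (- d) *: S (c *: x + d *: S x + 0 *: T x) + 0 *: T (c *: x + d *: S x + 0 *: T x) = 0.
    by rewrite Ey scale0r addr0.
  have [cds /eqP d0 _] := net_free3 cdx Ey0.
  move: cds cdx; rewrite oppr_eq0 in d0; rewrite (eqP d0) mul0r addr0 => ->.
  by rewrite !scale0r !addr0 eqxx.
have [c0 d0 _] := net_free3 x0 cd0.
have [|-> -> _] := @net_free3 x a b c x0; last by [].
by rewrite -[RHS]lin0 d0 scale0r addr0.
Qed.

Definition net_basis : 4.-tuple V := [tuple e; S e; T e; S (T e)].

Lemma net_basisP : basis_of {:V} net_basis.
Proof.
rewrite basisEfree subvf V4 leqnn !andbT; apply/freeP=> k.
rewrite !big_ord_recl big_ord0 /= addr0 !addrA => /(net_free4 e0)[k0 k1 k2 k3].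
case=> -[|[|[|[|//]]]] i4; [rewrite -[RHS]k0|rewrite -[RHS]k1|rewrite -[RHS]k2|rewrite -[RHS]k3];
  by congr k; apply: val_inj.
Qed.

Definition net_coord i y : F := coord net_basis (inord i) y.

Lemma net_coordE y :
  y = net_coord 0 y *: e + net_coord 1 y *: S e + net_coord 2 y *: T e
      + net_coord 3 y *: S (T e).
Proof.
rewrite [LHS](coord_basis net_basisP (memvf y)) !big_ord_recl big_ord0 /= addr0 !addrA.
by congr (_ *: _ + _ *: _ + _ *: _ + _ *: _); congr (coord _ _ _); apply: val_inj;
  rewrite /= inordK.
Qed.

(** Right multiplication by y is the operator in the span of 1, S, T, S T that
sends e to y. *)
Definition net_mul x y := net_coord 0 y *: x + net_coord 1 y *: S x
  + net_coord 2 y *: T x + net_coord 3 y *: S (T x).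

Lemma net_coord_lin a b c d : let y := a *: e + b *: S e + c *: T e + d *: S (T e) in
  [/\ net_coord 0 y = a, net_coord 1 y = b, net_coord 2 y = c & net_coord 3 y = d].
Proof.
move=> y; have := net_coordE y; rewrite {1}/y => ey.
have [] := @net_free4 e (net_coord 0 y - a) (net_coord 1 y - b)
  (net_coord 2 y - c) (net_coord 3 y - d) e0.
  apply: (addrI (a *: e + b *: S e + c *: T e + d *: S (T e))); rewrite addr0 [RHS]ey.
  by vector_ring.
by do 4![move/eqP; rewrite subr_eq0 => /eqP ->].
Qed.

Lemma net_mulE x a b c d :
  net_mul x (a *: e + b *: S e + c *: T e + d *: S (T e)) =
  a *: x + b *: S x + c *: T x + d *: S (T x).
Proof. by rewrite /net_mul; have [-> -> -> ->] := net_coord_lin a b c d. Qed.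

Lemma net_mul_linr x : linear (net_mul x).
Proof. by move=> a y z; rewrite /net_mul /net_coord !linearP /=; vector_ring. Qed.

Lemma net_mul_linl y : linear (net_mul^~ y).
Proof. by move=> a x z; rewrite /net_mul !linearP /=; vector_ring. Qed.

Lemma net_mulr1 x : net_mul x e = x.
Proof.
have := net_mulE x 1 0 0 0; rewrite !scale0r !scale1r !addr0; exact.
Qed.

Lemma net_mul1r y : net_mul e y = y.
Proof. by rewrite [RHS]net_coordE. Qed.

(** The operator z |-> S (z y) is in the span of 1, S, T, S T and sends e to
S y, so it is right multiplication by S y. *)
Lemma net_mulS x y : net_mul x (S y) = S (net_mul x y).
Proof.
rewrite {1}(net_coordE y).
set k0 := net_coord 0 y; set k1 := net_coord 1 y; set k2 := net_coord 2 y; set k3 := net_coord 3 y.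
have -> : S (k0 *: e + k1 *: S e + k2 *: T e + k3 *: S (T e)) =
   (k1 * n) *: e + (k0 + k1 * s) *: S e + (k3 * n) *: T e + (k2 + k3 * s) *: S (T e).
  by rewrite !linearD !linearZ /= !SS; vector_ring.
rewrite net_mulE /net_mul -/k0 -/k1 -/k2 -/k3.
by rewrite !linearD !linearZ /= !SS; vector_ring.
Qed.

Lemma net_TST x : T (S (T x)) = ((r - t) * m) *: x + (- m) *: S x
   + ((r - t) * t + g) *: T x + (r - s - t) *: S (T x).
Proof. by rewrite TS !TT !linearD !linearZ /=; vector_ring. Qed.

(** As for S, using the relations to rewrite T S and T S T. *)
Lemma net_mulT x y : net_mul x (T y) = T (net_mul x y).
Proof.
rewrite {1}(net_coordE y).
set k0 := net_coord 0 y; set k1 := net_coord 1 y; set k2 := net_coord 2 y; set k3 := net_coord 3 y.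
have key z : T (k0 *: z + k1 *: S z + k2 *: T z + k3 *: S (T z)) =
   (k1 * g + k2 * m + k3 * ((r - t) * m)) *: z
   + (k1 * (r - s) - k3 * m) *: S z
   + (k0 + k1 * (r - t) + k2 * t + k3 * ((r - t) * t + g)) *: T z
   + (k3 * (r - s - t) - k1) *: S (T z).
  by rewrite !linearD !linearZ /= net_TST !TT !TS; vector_ring.
by rewrite key net_mulE /net_mul -/k0 -/k1 -/k2 -/k3 key.
Qed.

Lemma net_mulA : associative net_mul.
Proof.
move=> x y z.
have D u v : net_mul x (u + v) = net_mul x u + net_mul x v.
  by have := net_mul_linr x 1 u v; rewrite !scale1r.
have Z a u : net_mul x (a *: u) = a *: net_mul x u.
  have := net_mul_linr x a u 0; rewrite addr0 => ->.
  by rewrite /net_mul /net_coord !linear0 !scale0r !addr0.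
by rewrite {2}/net_mul !D !Z !net_mulS net_mulT.
Qed.

Definition net_algebra : algebra_on V :=
  AlgebraOn (conj net_mul_linr net_mul_linl) net_mulA net_mul1r net_mulr1.

Let mB := amul_bilinear net_algebra.

Lemma net_mul_eq0 x y : x != 0 -> net_mul x y = 0 -> y = 0.
Proof.
move=> x0 /(net_free4 x0)[k0 k1 k2 k3].
by rewrite [y]net_coordE k0 k1 k2 k3 !scale0r !addr0.
Qed.

Lemma net_mul_surj x z : x != 0 -> exists y, net_mul x y = z.
Proof.
move=> x0; pose f := linfun (net_mul x).
have fE y : f y = net_mul x y by apply: (linfun_bilr _ _ mB).
have : limg f = fullv.
  apply/eqP; rewrite eqEdim subvf limg_dim_eq ?leqnn// capfv.
  apply/eqP; rewrite -subv0; apply/subvP=> y; rewrite memv_ker memv0 fE.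
  by move=> /eqP/(net_mul_eq0 x0) ->.
by move=> fV; have := memvf z; rewrite -fV => /memv_imgP[y _ ->]; exists y.
Qed.

Lemma net_skew_field : is_skew_field net_algebra.
Proof.
split; first exact/eqP.
move=> x /eqP x0; have [y xy] := net_mul_surj e x0.
have y0 : y != 0.
  apply: contraNneq e0 => y0; rewrite -xy y0; exact/eqP/(bil0r mB).
have [z yz] := net_mul_surj e y0; exists y; split=> //.
suff <- : z = x by [].
by rewrite -[LHS]net_mul1r -xy -net_mulA yz net_mulr1.
Qed.

(** S and T being skew and self-adjoint, every pairing of u, S u, T u with
u, S u, T u, S T u is a scalar multiple of w0 u (S T u). *)
Lemma net_pairing u h : let k := w0 u (S (T u)) in
  [/\ w0 u (net_mul u h) = net_coord 3 h * k,
      w1 u (net_mul u h) = (net_coord 2 h + s * net_coord 3 h) * k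
    & w2 u (net_mul u h) = - net_coord 1 h * k].
Proof.
move=> k; have A1 : alternating_map w1 by case: net => -[].
have A2 : alternating_map w2 by case: net => -[].
have netT := form_net_swap net.
have Sk := net_skew net Sw; have Tk := net_skew netT Tw.
have Sa := net_adjoint net Sw; have Ta := net_adjoint netT Tw.
rewrite /net_mul; set k0 := net_coord 0 h; set k1 := net_coord 1 h.
set k2 := net_coord 2 h; set k3 := net_coord 3 h.
have zero x : w0 (S x) x = 0 by rewrite -Sa Sk.
have zeroT x : w0 (T x) x = 0 by rewrite -Ta Tk.
have kST : w0 (S u) (T u) = k by rewrite -Sa.
have kTS : w0 (T u) (S u) = - k by rewrite (alternating_mapC A0) kST.
have kSS : w0 (S u) (S (T u)) = s * k.
  by rewrite -Sa SS (bilDr A0.1) !(bilZr A0.1) Tk scaler0 addr0.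
rewrite -Sw -Tw !(bilDr A0.1) !(bilZr A0.1) !(altxx _ A0) !Sk Tk zero zeroT kST kTS kSS -/k.
by rewrite !scaler0 !add0r !addr0; split=> //; rewrite -?[_ *: _]/(_ * _); ring.
Qed.

Lemma net_pairing_neq0 u : u != 0 -> w0 u (S (T u)) != 0.
Proof.
move=> u0; apply/eqP=> k0; have [_ _ /(_ u 1 0 0 u0)[y|/eqP]] := net; last first.
  by rewrite oner_eq0.
have [h <-] := net_mul_surj y u0.
by have [-> -> ->] := net_pairing u h; rewrite k0; ring.
Qed.

(** If v = u h then c v = (c u) h, and by [net_pairing] the values at (u, u h)
and (c u, c u h) are two scalars times the same linear functions of h. *)
Lemma net_left_multiplication c u v : u != 0 -> exists a : F,
  [/\ w0 (net_mul c u) (net_mul c v) = a * w0 u v,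
      w1 (net_mul c u) (net_mul c v) = a * w1 u v
    & w2 (net_mul c u) (net_mul c v) = a * w2 u v].
Proof.
move=> u0; have [h <-] := net_mul_surj v u0; rewrite net_mulA.
have k0 := net_pairing_neq0 u0; set cu := net_mul c u.
exists (w0 cu (S (T cu)) / w0 u (S (T u))).
have [-> -> ->] := net_pairing u h; have [-> -> ->] := net_pairing cu h.
by split; field.
Qed.

Section Commuting.
Hypothesis comm_e : T (S e) = S (T e).

(** If T S = S T, the relation for T S becomes 2 S T = (r - s) S + (r - t) T + g,
and by independence 2 = 0 and r = s = t. Pairing S T e with itself then gives
0 = s t w0 e (S T e), so s = t = 0. *)
Lemma net_commuting : [/\ 2%:R = 0 :> F, s = 0 & t = 0].
Proof.
have : (- g) *: e + (s - r) *: S e + (t - r) *: T e + 2%:R *: S (T e) = 0.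
  have := TS e; rewrite comm_e => /eqP; rewrite -subr_eq0 => /eqP <-.
  by vector_ring.
case/(net_free4 e0)=> g0 sr tr two0.
have [gE sE tE] : [/\ g = 0, r = s & r = t].
  split; first by apply/eqP; rewrite -oppr_eq0 g0.
    by apply/esym/eqP; rewrite -subr_eq0 sr.
  by apply/esym/eqP; rewrite -subr_eq0 tr.
have twoV (x : V) : x + x = 0 by rewrite -mulr2n -scaler_nat two0 scale0r.
have comm x : T (S x) = S (T x).
  rewrite TS gE -{1}sE -tE !subrr !scale0r !addr0.
  by apply/eqP; rewrite eq_sym -addr_eq0 twoV.
have st0 : s * t = 0.
  have Sk := net_skew net Sw; have Tk := net_skew (form_net_swap net) Tw.
  (* 0 = w0 (S T e) (S T e) = w0 e (T S S T e), and only S T e pairs with e. *)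
  have expand : T (S (S (T e))) =
      (s * t) *: S (T e) + (s * m) *: S e + (n * t) *: T e + (n * m) *: e.
    rewrite SS linearD !linearZ /= comm TT linearD !linearZ /=; vector_ring.
  have := altxx (S (T e)) A0.
  rewrite -(net_adjoint net Sw) -(net_adjoint (form_net_swap net) Tw) expand.
  rewrite !(bilDr A0.1) !(bilZr A0.1) Sk Tk (altxx _ A0) !scaler0 !addr0.
  move/eqP; rewrite scaler_eq0 (negbTE (net_pairing_neq0 e0)) orbF.
  by move/eqP.
have st : s = t by rewrite -sE.
by move: st0; rewrite st => /eqP; rewrite mulf_eq0 orbb => /eqP.
Qed.

(** Now S S, T T are scalars and S, T commute; in characteristic 2 squaring is
additive. *)
Lemma net_square_central_field : is_square_central_quartic_field net_algebra.
Proof.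
have [two0 s0 t0] := net_commuting.
have D x : {morph net_mul x : u v / u + v}.
  by move=> u v; have := net_mul_linr x 1 u v; rewrite !scale1r.
have Z x a : {morph net_mul x : u / a *: u}.
  move=> u; exact: (bilZr mB).
have Dl y u v : net_mul (u + v) y = net_mul u y + net_mul v y by exact: (bilDl mB).
have Zl y a u : net_mul (a *: u) y = a *: net_mul u y by exact: (bilZl mB).
have comm x : T (S x) = S (T x).
  by rewrite -[x]net_mulr1 -!(net_mulS, net_mulT) comm_e.
split=> //.
- exact: net_skew_field.
- move=> x y /=; have Sl u v : net_mul (S u) v = S (net_mul u v).
    by rewrite /net_mul !(linearD, linearZ) /= !comm.
  have Tl u v : net_mul (T u) v = T (net_mul u v).
    by rewrite /net_mul !(linearD, linearZ) /= !comm.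
  by rewrite [x in LHS]net_coordE !Dl !Zl !(Sl, Tl) net_mul1r.
move=> h /=; have two (z : V) : 2%:R *: z = 0 by rewrite two0 scale0r.
rewrite (net_coordE h) net_mulE.
set a := net_coord 0 h; set b := net_coord 1 h.
set c := net_coord 2 h; set d := net_coord 3 h.
apply/vlineP; exists (a * a + b * b * n + c * c * m + d * d * n * m).
rewrite -[RHS]addr0 -(two ((a * b + c * d * m) *: S e + (a * c + b * d * n) *: T e
  + (a * d + b * c) *: S (T e))).
rewrite !(linearD, linearZ) /= !(comm, SS, TT, linearD, linearZ) /= ?(comm, SS, TT) s0 t0.
by vector_ring.
Qed.

End Commuting.

(** A central element commutes with S e and T e, so it lies in the span of e and
S e and in the span of e and T e, which meet in the multiples of e. *)
Lemma net_quaternion : T (S e) <> S (T e) -> is_quaternion_skew_field net_algebra.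
Proof.
move=> ncomm; split=> //; first exact: net_skew_field.
have eS x : net_mul x (S e) = S x by rewrite net_mulS net_mulr1.
have eT x : net_mul x (T e) = T x by rewrite net_mulT net_mulr1.
move=> z; split=> [zC|/vlineP[a ->] x]; last first.
  by rewrite (bilZl mB) (bilZr mB) /= net_mulr1 net_mul1r.
have := centralizer_dim2 net_skew_field V4 (x := S e) (y := T e) (z := z).
rewrite /= eT eS => /(_ ncomm (zC _))/vlineP2[a [b ez]].
have := centralizer_dim2 net_skew_field V4 (x := T e) (y := S e) (z := z).
rewrite /= eT eS => /(_ (nesym ncomm) (zC _))/vlineP2[a' [b' ez']].
have [|_ b0 _] := @net_free3 e (a - a') b (- b') e0.
  rewrite -[RHS](subrr z) {1}ez ez'; vector_ring.
by apply/vlineP; exists a; rewrite ez b0 scale0r addr0.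
Qed.

(** Two operators of the algebra are equal once they agree at e, so it is
enough to compare T S e with S T e. *)
Lemma net_algebra_clifford :
  is_quaternion_skew_field net_algebra \/ is_square_central_quartic_field net_algebra.
Proof.
have [c|c] := eqVneq (T (S e)) (S (T e)).
  by right; apply: net_square_central_field.
by left; apply: net_quaternion; apply/eqP.
Qed.

End NetAlgebra.

(** * Clifford parallelisms and external planes *)

Lemma direction_form_net (F : fieldType) (V Q : vectType F) (K : {vspace Q})
    (b : V -> V -> Q) (X : 3.-tuple Q) :
  \dim {:V} = 4%N -> direction_map K b -> basis_of K X ->
  form_net (fun x y => coord X 0 (b x y)) (fun x y => coord X 1 (b x y))
    (fun x y => coord X 2%:R (b x y)).
Proof.
move=> V4 bK XK; have [[bB b0] bF dK bin] := bK.
have A i : alternating_map (fun x y => coord X i (b x y) : F^o).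
  split; last by move=> x; rewrite b0 linear0.
  by split=> x a y z; rewrite ?(bilDr bB) ?(bilZr bB) ?(bilDl bB) ?(bilZl bB) linearP.
split=> // [x y x0 e0 e1 e2|x a c d x0 e].
  apply: bF => //; rewrite (coord_basis XK (bin x y)) !big_ord_recl big_ord0.
  have -> : lift ord0 (ord0 : 'I_2) = 1 by apply: val_inj.
  have -> : lift ord0 (lift ord0 (ord0 : 'I_1)) = 2%:R by apply: val_inj.
  by rewrite e0 e1 e2 !scale0r !addr0.
have val (i : 'I_3) : a * (i == 0)%:R + c * (i == 1)%:R + d * (i == 2%:R)%:R = 0.
  have XiK : X`_i \in K by apply: (basis_mem XK); rewrite mem_nth ?size_tuple.
  have [y ey] := direction_surj V4 bK x0 XiK; have := e y.
  by rewrite ey !(coord_free i) ?(basis_free XK).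
have := (val 0, val 1, val 2%:R); rewrite /= !(mulr0, mulr1, addr0, add0r).
by case=> [[]].
Qed.

(** The three coordinates of b form a net, and left multiplications in the
algebra of this net preserve directions. *)
Lemma direction_map_clifford (F : fieldType) (V Q : vectType F) (K : {vspace Q})
    (b : V -> V -> Q) : \dim {:V} = 4%N -> direction_map K b ->
  exists H : algebra_on V,
    (is_quaternion_skew_field H \/ is_square_central_quartic_field H) /\
    forall M N, same_direction b M N <-> left_parallel H M N.
Proof.
move=> V4 bK; have [bA _ dK bin] := bK.
have [X XK] : exists X : 3.-tuple Q, basis_of K X.
  by rewrite -dK; exists (vbasis K); apply: vbasisP.
have net := direction_form_net V4 bK XK.
set w0 := (fun x y => _) in net; set w1 := (fun x y => coord X 1 _) in net.
set w2 := (fun x y => coord X 2%:R _) in net.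
have [[A0 A1 A2] _ nd] := net.
have e0 : vpick {:V} != 0 by rewrite vpick0 -dimv_eq0 V4.
have nd0 x : (forall y, w0 x y = 0) -> x = 0.
  move=> w0x; apply/eqP/contraT => x0; have [|/eqP] := nd x 1 0 0 x0.
    by move=> y; rewrite w0x; ring.
  by rewrite oner_eq0.
have [S Sw] := form_operator A0.1 A1.1 nd0.
have [T Tw] := form_operator A0.1 A2.1 nd0.
have STw x y : w0 ((S + T) x) y = w1 x y + w2 x y.
  by rewrite add_lfunE (bilDl A0.1) Sw Tw.
have [s [n SS]] := net_quadratic net Sw e0.
have [t [m TT]] := net_quadratic (form_net_swap net) Tw e0.
have [r [k STST]] := net_quadratic (form_net_shear net) STw e0.
have TS x : T (S x) = - S (T x) + (r - s) *: S x + (r - t) *: T x + (k - n - m) *: x.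
  have := STST x; rewrite !add_lfunE !linearD /= SS TT => E.
  have -> : T (S x) = (s *: S x + n *: x + S (T x) + (T (S x) + (t *: T x + m *: x)))
    - s *: S x - n *: x - S (T x) - t *: T x - m *: x by vector_ring.
  by rewrite E; vector_ring.
pose H := net_algebra V4 net e0 Sw Tw SS TT TS.
exists H; split; first exact: net_algebra_clifford.
apply: (same_direction_left_parallel V4 _ bK); first exact: net_skew_field.
move=> c u v _ u0 _.
have [a [E0 E1 E2]] := net_left_multiplication V4 net e0 Sw Tw SS TT TS c v u0.
exists a; rewrite (coord_basis XK (bin _ _)) [in RHS](coord_basis XK (bin u v)).
rewrite !big_ord_recl !big_ord0.
have -> : lift ord0 (ord0 : 'I_2) = 1 by apply: val_inj.
have -> : lift ord0 (lift ord0 (ord0 : 'I_1)) = 2%:R by apply: val_inj.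
rewrite -!/(w0 _ _) -!/(w1 _ _) -!/(w2 _ _) E0 E1 E2.
by vector_ring.
Qed.

Lemma clifford_direction_map (F : fieldType) (V : vectType F) (H : algebra_on V) :
  \dim {:V} = 4%N ->
  is_quaternion_skew_field H \/ is_square_central_quartic_field H ->
  exists (K : {vspace V}) (b : V -> V -> V), direction_map K b /\
    forall M N, same_direction b M N <-> left_parallel H M N.
Proof.
move=> V4 Hcl; have Hsf : is_skew_field H by case: Hcl => -[].
have [s [sx s0]] := clifford_conjugation Hcl.
exact: (conjugation_direction_map V4 Hsf sx s0).
Qed.

Theorem mainTheorem3 (F : fieldType) (V : vectType F) (hV : \dim {:V} = 4%N)
    (W : vectType F) (w : V -> V -> W) (hw : is_exterior_square w) :
  set_bij [set C : {vspace W} | external_plane w C]%classic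
          [set P : line V -> line V -> Prop | is_clifford P]%classic
          (par_plane w).
Proof.
have e0 : vpick {:V} != 0 by rewrite vpick0 -dimv_eq0 hV.
set e := vpick _ in e0.
have par_eq (P : line V -> line V -> Prop) C :
    (forall M N, par_plane w C M N <-> P M N) -> par_plane w C = P.
  by move=> PC; apply/funext=> M; apply/funext=> N; apply/propext/PC.
split=> [C extC|C D /set_mem extC /set_mem extD eCD|P [_ [H [Hcl HP]]]] /=.
- have [p [kp _ bK]] := external_projection hV hw extC e0.
  have parE : par_plane w C = same_direction (fun x y => p (w x y)).
    by apply: par_eq => M N; rewrite -kp; apply: par_plane_lker.
  have [H [Hcl HP]] := direction_map_clifford hV bK.
  rewrite parE; split; first exact: same_direction_parallelism hV bK.
  by exists H; split; [|left].
- have [p [kp pe bp]] := external_projection hV hw extC e0.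
  have [q [kq qe bq]] := external_projection hV hw extD e0.
  rewrite -kp -kq; congr lker; apply: (exterior_square_ext hw).
  apply: (direction_rigid hV bp bq _ e0) => [M N|x]; last by rewrite pe qe.
  by rewrite -!par_plane_lker kp kq eCD.
- have [H' [Hcl' HP']] : exists H' : algebra_on V,
      (is_quaternion_skew_field H' \/ is_square_central_quartic_field H') /\
      forall M N, P M N <-> left_parallel H' M N.
    case: HP => HP; first by exists H.
    by exists (opposite_algebra H); split; first exact: opposite_clifford.
  have [K [b [bK bH]]] := clifford_direction_map hV Hcl'.
  have [C [extC parC]] := direction_map_external hV hw bK.
  exists C => //; apply: par_eq => M N; rewrite parC bH.
  by split=> /HP'.
Qed.
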